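(* Let $\Phi\colon\mathrm{Conv}_{\mathrm c}(\mathbb{R}^n)\to[-\infty,\infty]$ be upper semicontinuous, concave, and monotone decreasing. Then $$\Phi^*(\psi,\mathcal{Y})\le\Phi^*(\psi_{\mathrm{rot}},\mathcal{Y})$$ for every $\psi\in\mathrm{Conv}_{\mathrm c}(\mathbb{R}^n)$ and every $\mathcal{Y}\subseteq\mathscr{Y}_\psi$. In particular, $q_{\psi\circ\vartheta^{-1},Y}\in\mathrm{Conv}_{\mathrm c}(\mathbb{R}^n)$ and $q_{\psi_{\mathrm{rot}}\circ\vartheta^{-1},Y}\in\mathrm{Conv}_{\mathrm c}(\mathbb{R}^n)$ for every $Y\in\mathcal{Y}$ and $\vartheta\in \mathrm{O}(n)$, so that $\Phi^*(\psi,\mathcal{Y})$ and $\Phi^*(\psi_{\mathrm{rot}},\mathcal{Y})$ are well-defined.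
   Context: $\mathrm{Conv}_{\mathrm c}(\mathbb{R}^n)$ is the set of convex functions $\psi\colon\mathbb{R}^n\to(-\infty,\infty]$ that are proper ($\psi\not\equiv\infty$), lower semicontinuous, and coercive ($\lim_{|x|\to\infty}\psi(x)=\infty$). Here $n\ge1$. Epi-sum: $(\psi_1\,\square\,\psi_2)(x)=\inf_{y\in\mathbb{R}^n}(\psi_1(x-y)+\psi_2(y))$. Epi-multiplication: $(\lambda\cdot_{\mathrm e}\psi)(x)=\lambda\psi(x/\lambda)$ for $\lambda>0$. Convention: a functional ''with values in $[-\infty,\infty]$'' takes values either in $(-\infty,\infty]$ or in $[-\infty,\infty)$. $\Phi$ is concave if $\Phi\big((\lambda\cdot_{\mathrm e}\psi_1)\,\square\,((1-\lambda)\cdot_{\mathrm e}\psi_2)\big)\ge \lambda\Phi(\psi_1)+(1-\lambda)\Phi(\psi_2)$ for all $\psi_1,\psi_2$ and $\lambda\in(0,1)$. $\Phi$ is monotone decreasing if $\Phi(\psi_1)\le\Phi(\psi_2)$ whenever $\psi_1\ge\psi_2$ pointwise. Semicontinuity is with respect to the topology of epi-convergence: $\psi_j$ epi-converges to $\psi$ if for every $x\in\mathbb{R}^n$, (i) $\psi(x)\le\liminf_j\psi_j(x_j)$ for every $x_j\to x$, and (ii) $\psi(x)=\lim_j\psi_j(x_j)$ for some $x_j\to x$. Legendre--Fenchel transform: $\mathcal{L}\psi(x)=\sup_{y\in\mathbb{R}^n}(\langle x,y\rangle-\psi(y))$; $\mathrm{dom}(\varphi)=\{x:\varphi(x)<\infty\}$.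 $B_n$ is the closed Euclidean unit ball. For $\psi\in\mathrm{Conv}_{\mathrm c}(\mathbb{R}^n)$, $r(\psi)=\sup\{r\ge0: rB_n\subseteq\mathrm{dom}(\mathcal{L}\psi)\}\in(0,\infty]$, with the convention $r(\psi)B_n=\mathbb{R}^n$ if $r(\psi)=\infty$. Generalized outer linearization: for $\psi\in\mathrm{Conv}_{\mathrm c}(\mathbb{R}^n)$ and $y\in\mathbb{R}^n$, $\ell_{\psi,y}(x)=\langle x,y\rangle+c$ with $c\in[-\infty,\infty)$ maximal such that $\ell_{\psi,y}\le\psi$ pointwise ($c=-\infty$, i.e. $\ell_{\psi,y}\equiv-\infty$, if no real $c$ works). For nonempty $Y\subseteq\mathbb{R}^n$, $q_{\psi,Y}(x)=\sup_{y\in Y}\ell_{\psi,y}(x)$. Admissible slope sets: $\mathscr{Y}_\psi=\{Y\subseteq\mathbb{R}^n:\exists\,Y_o\subseteq Y\text{ with }\mathrm{pos}(Y_o)=\mathbb{R}^n\text{ and }Y_o\subseteq\mathrm{int}(r(\psi)B_n)\}$, where $\mathrm{pos}$ denotes the positive hull (all finite nonnegative linear combinations). For $n\ge2$, $\Phi^*(\varphi,\mathcal{Y})=\inf\{\Phi(q_{\varphi\circ\vartheta^{-1},Y}):\vartheta\in \mathrm{SO}(n),\,Y\in\mathcal{Y}\}$; for $n=1$, the same definition with $\mathrm{O}(1)=\{\pm1\}$ in place of $\mathrm{SO}(1)$. Rotational epi-symmetrization: for $n\ge2$, $\psi_{\mathrm{rot}}$ is the unique function in $\mathrm{Conv}_{\mathrm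 c}(\mathbb{R}^n)$ with $\mathcal{L}\psi_{\mathrm{rot}}(x)=\int_{\mathrm{SO}(n)}\mathcal{L}\psi(\vartheta^{-1}x)\,\mathrm{d}\vartheta$ for all $x$ (Haar probability measure). For $n=1$, $\psi_{\mathrm{rot}}=\tfrac12\cdot_{\mathrm e}(\psi\,\square\,\psi^-)$ with $\psi^-(x)=\psi(-x)$. *)

(* Defs.v *)
From HB Require Import structures.
From mathcomp Require Import all_boot all_order all_algebra.
From mathcomp Require Import all_classical all_reals all_analysis.
Import Order.TTheory GRing.Theory Num.Theory.
Import numFieldNormedType.Exports.

Set Implicit Arguments.
Unset Strict Implicit.
Unset Printing Implicit Defensive.

Local Open Scope classical_set_scope.
Local Open Scope ring_scope.
Local Open Scope ereal_scope.

Section euclidean.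
Context {R : realType} {n : nat}.
Implicit Types (x y : 'cV[R]_n) (A : set 'cV[R]_n) (g : 'M[R]_n).

Definition dotp x y : R := (\sum_(i < n) x i 0 * y i 0)%R.

(* The library norm on matrices is the sup norm, hence a separate name. *)
Definition enorm x : R := Num.sqrt (dotp x x).

Definition unit_ball : set 'cV[R]_n := [set x | (enorm x <= 1)%R].

(* The dilate r B_n, with r B_n = R^n for r = +oo. *)
Definition dilated_ball (r : \bar R) : set 'cV[R]_n :=
  match r with
  | s%:E => [set (s *: x)%R | x in unit_ball]
  | +oo => setT
  | -oo => set0
  end.

Definition pos A : set 'cV[R]_n :=
  [set x | exists (k : nat) (a : 'I_k -> R) (v : 'I_k -> 'cV[R]_n),
     (forall i, (0 <= a i)%R /\ A (v i)) /\ x = (\sum_(i < k) a i *: v i)%R].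

Definition orthogonal_group : set 'M[R]_n :=
  [set g | (g *m g^T)%R = (1%:M)%R].

Definition special_orthogonal_group : set 'M[R]_n :=
  [set g | orthogonal_group g /\ (\det g = 1)%R].

End euclidean.

Arguments orthogonal_group R n : clear implicits.
Arguments special_orthogonal_group R n : clear implicits.

Section convex_functions.
Context {R : realType} {n : nat}.
Implicit Types (psi phi : 'cV[R]_n -> \bar R) (x y : 'cV[R]_n).

Definition econvex psi := forall x y (t : R), (0 < t < 1)%R ->
  psi (t *: x + (1 - t) *: y)%R <= t%:E * psi x + (1 - t)%:E * psi y.

Definition proper psi := exists x, psi x != +oo.

Definition coercive psi := forall M : R, exists K : R,
  forall x, (K < enorm x)%R -> M%:E < psi x.

Definition Conv_c : set ('cV[R]_n -> \bar R) :=
  [set psi | [/\ forall x, psi x != -oo, econvex psi, proper psi,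
                 lower_semicontinuous psi & coercive psi]].

Definition epi_sum psi phi : 'cV[R]_n -> \bar R :=
  fun x => ereal_inf [set psi (x - y)%R + phi y | y in [set: 'cV[R]_n]].

Definition epi_mul (lam : R) psi : 'cV[R]_n -> \bar R :=
  fun x => lam%:E * psi (lam^-1 *: x)%R.

Definition epi_cvg (psi_ : nat -> 'cV[R]_n -> \bar R) psi := forall x,
  (forall x_ : nat -> 'cV[R]_n, x_ @ \oo --> x ->
     psi x <= limn_einf (fun j => psi_ j (x_ j))) /\
  (exists2 x_ : nat -> 'cV[R]_n, x_ @ \oo --> x &
     (fun j => psi_ j (x_ j)) @ \oo --> psi x).

Definition legendre psi : 'cV[R]_n -> \bar R :=
  fun x => ereal_sup [set (dotp x y)%:E - psi y | y in [set: 'cV[R]_n]].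

Definition edom psi : set 'cV[R]_n := [set x | psi x < +oo].

Definition inner_radius psi : \bar R :=
  ereal_sup [set r%:E | r in
    [set r : R | (0 <= r)%R /\ dilated_ball r%:E `<=` edom (legendre psi)]].

(* The set of admissible constants always contains -oo.  When psi is proper,
   the set is bounded above by a real number and its supremum is attained, so
   this is the maximal admissible constant. *)
Definition support_const psi y : \bar R :=
  ereal_sup [set c : \bar R | c < +oo /\
    forall x, (dotp x y)%:E + c <= psi x].

Definition support_fun psi y : 'cV[R]_n -> \bar R :=
  fun x => (dotp x y)%:E + support_const psi y.

Definition outer_lin psi (Y : set 'cV[R]_n) : 'cV[R]_n -> \bar R :=
  fun x => ereal_sup [set support_fun psi y x | y in Y].

Definition admissible_slopes psi : set (set 'cV[R]_n) :=
  [set Y | exists Yo : set 'cV[R]_n,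
    [/\ Yo `<=` Y, pos Yo = setT &
        Yo `<=` interior (dilated_ball (inner_radius psi))]].

Definition rotate (g : 'M[R]_n) psi : 'cV[R]_n -> \bar R :=
  fun x => psi (invmx g *m x)%R.

Definition reflect_fun psi : 'cV[R]_n -> \bar R := fun x => psi (- x)%R.

End convex_functions.

Arguments Conv_c R n : clear implicits.

(* Functionals are total on functions R^n -> [-oo, +oo]; only their values on
   Conv_c are constrained. *)
Section functionals.
Context {R : realType} {n : nat}.
Implicit Type Phi : ('cV[R]_n -> \bar R) -> \bar R.

Definition one_sided_values Phi :=
  (forall psi, Conv_c R n psi -> Phi psi != -oo) \/
  (forall psi, Conv_c R n psi -> Phi psi != +oo).

Definition usc_functional Phi :=
  forall (psi_ : nat -> 'cV[R]_n -> \bar R) (psi : 'cV[R]_n -> \bar R),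
  (forall j, Conv_c R n (psi_ j)) -> Conv_c R n psi -> epi_cvg psi_ psi ->
  limn_esup (fun j => Phi (psi_ j)) <= Phi psi.

Definition concave_functional Phi :=
  forall (psi1 psi2 : 'cV[R]_n -> \bar R) (lam : R),
  Conv_c R n psi1 -> Conv_c R n psi2 -> (0 < lam < 1)%R ->
  lam%:E * Phi psi1 + (1 - lam)%:E * Phi psi2 <=
  Phi (epi_sum (epi_mul lam psi1) (epi_mul (1 - lam)%R psi2)).

Definition decreasing_functional Phi :=
  forall psi1 psi2 : 'cV[R]_n -> \bar R,
  Conv_c R n psi1 -> Conv_c R n psi2 ->
  (forall x, psi2 x <= psi1 x) -> Phi psi1 <= Phi psi2.

Definition rotations : set 'M[R]_n :=
  if n == 1%N then orthogonal_group R n else special_orthogonal_group R n.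

Definition Phi_star Phi (phi : 'cV[R]_n -> \bar R)
    (YY : set (set 'cV[R]_n)) : \bar R :=
  ereal_inf [set v | exists g Y,
    [/\ rotations g, YY Y & v = Phi (outer_lin (rotate g phi) Y)]].

End functionals.

Definition borel_mx (R : realType) (n : nat) :=
  g_sigma_algebraType (@open 'M[R]_n).

(* Haar probability measure of SO(n), as a Borel measure on the space of all
   n x n matrices that is concentrated on SO(n). *)
Definition haar_SO (R : realType) (n : nat)
    (mu : probability (borel_mx R n) R) :=
  mu (special_orthogonal_group R n) = 1 /\
  forall (g : 'M[R]_n) (A : set (borel_mx R n)),
    special_orthogonal_group R n g -> measurable A ->
    mu [set h : 'M[R]_n | A (g *m h)%R] = mu A.

Definition is_rot_epi_sym (R : realType) (n : nat)
    (mu : probability (borel_mx R n) R) (psi psi_rot : 'cV[R]_n -> \bar R) :=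
  if n == 1%N then
    psi_rot = epi_mul (2^-1)%R (epi_sum psi (reflect_fun psi))
  else
    Conv_c R n psi_rot /\
    forall x, legendre psi_rot x =
      \int[mu]_(g in special_orthogonal_group R n)
        legendre psi (invmx (g : 'M[R]_n) *m x)%R.

(* Main.v *)
Require Import Defs.
From mathcomp Require Import all_boot all_order all_algebra.
From mathcomp Require Import all_classical all_reals all_analysis.
From mathcomp Require Import perm measurable_realfun.
From mathcomp Require Import ring lra.
Import Order.TTheory GRing.Theory Num.Theory.
Import numFieldNormedType.Exports.

Set Implicit Arguments.
Unset Strict Implicit.
Unset Printing Implicit Defensive.

Local Open Scope classical_set_scope.
Local Open Scope ring_scope.
Local Open Scope ereal_scope.

(** Write [phi] for the Legendre transform of [psi].  The outer linearization of
    [psi] composed with the inverse of a rotation [g] is the supremum over [y] in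
    [Y] of the affine functions [x |-> <x,y> - phi (g^-1 y)].  Everything takes
    place at the level of such suprema [affine_sup v Y], where [v] prescribes
    the constant of the affine function of slope [y].

    Let [V = Phi_star Phi psi YY], fix [Y] in [YY], and call a function [h] of
    [Conv_c] good if [Phi h >= V].  All outer linearizations with slopes in [Y]
    of rotated copies of [psi] are good.  Concavity of [Phi] makes good functions
    stable under epi-means, and an epi-mean of two functions lies above the
    affine function of slope [y] whose constant is the same mean of their
    constants ([epi_mean_minorant]).  Hence, if [u y] is a finite convex
    combination of numbers [phi (g_i^-1 y)] with the same rotations [g_i] and
    weights for all [y], then some good function lies above all the functions
    [<.,y> - u y]; by monotonicity, any smaller function of [Conv_c] is good too.

    For [n = 1] the epi-mean of [psi] over the two rotations 1 and -1 is [psi_rot],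
    and the theorem follows at once.  For [n >= 2] the constants of [psi_rot] are
    averages [v y] of [phi (g^-1 y)] over the group.  Finitely many of them can be undercut
    simultaneously, up to any [e > 0], by finite convex combinations
    ([finite_epi_mean_minorant]).  This one-sided approximation holds wherever
    [v y] is finite, so it covers slopes on the boundary of the domain of
    [phi], near which [phi] can be unbounded.  It rests on two facts: for every
    choice of nonnegative weights [w], not all 0, some rotation makes the [w]-weighted sum of
    the [phi (g^-1 y)] at most its mean plus a small multiple of the total weight,
    while these values stay below a bound independent of [w] ([integral_selection]);
    and a convex set of vectors that meets all half-spaces
    [{u | sum of w (u - p) <= 0}] in a fixed bounded region comes arbitrarily close to
    the orthant [{u | u <= p}] ([approachability], Blackwell's argument).

    So the supremum of finitely many of the affine functions defining the outer
    linearization of [psi_rot], lowered by [e], is good.  Along an exhaustion by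
    finite sets of a countable set of slopes with the same supremum, and
    with [e] tending to 0, these suprema epi-converge to the outer linearization of
    [psi_rot] ([affine_sup_limit]), and upper semicontinuity of [Phi] gives the
    inequality.

    Membership in [Conv_c] requires coercivity, which comes from slopes whose
    positive hull is the whole space, and finiteness of the constants at
    these slopes.  The slopes in [Yo] lie strictly inside a ball on which [phi] is
    finite; there [phi] is bounded on every smaller ball
    ([legendre_bounded]), hence so are its averages over rotations. *)

(** * Euclidean geometry of column vectors *)

Section geometry.
Local Open Scope ring_scope.
Context {R : realType} {n : nat}.
Implicit Types (x y z : 'cV[R]_n) (g : 'M[R]_n) (t : R).

Lemma dotpE x y : dotp x y = (x^T *m y) 0 0.
Proof. by rewrite /dotp mxE; apply: eq_bigr => i _; rewrite mxE. Qed.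

Lemma dotpC x y : dotp x y = dotp y x.
Proof. by apply: eq_bigr => i _; rewrite mulrC. Qed.

Lemma dotpDr x y z : dotp x (y + z) = dotp x y + dotp x z.
Proof. by rewrite !dotpE mulmxDr mxE. Qed.

Lemma dotpDl x y z : dotp (y + z) x = dotp y x + dotp z x.
Proof. by rewrite dotpC dotpDr !(dotpC x). Qed.

Lemma dotpZr x y t : dotp x (t *: y) = t * dotp x y.
Proof. by rewrite !dotpE -scalemxAr mxE. Qed.

Lemma dotpZl x y t : dotp (t *: x) y = t * dotp x y.
Proof. by rewrite dotpC dotpZr dotpC. Qed.

Lemma dotpNr x y : dotp x (- y) = - dotp x y.
Proof. by rewrite -scaleN1r dotpZr mulN1r. Qed.

Lemma dotpNl x y : dotp (- x) y = - dotp x y.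
Proof. by rewrite dotpC dotpNr dotpC. Qed.

Lemma dotp_sumr x (I : Type) (r : seq I) (F : I -> 'cV[R]_n) :
  dotp x (\sum_(i <- r) F i) = \sum_(i <- r) dotp x (F i).
Proof.
elim/big_rec2 : _ => [|i a b _ <-]; last by rewrite dotpDr.
by rewrite dotpE mulmx0 mxE.
Qed.

Lemma dotp_delta x (i : 'I_n) : dotp x (delta_mx i 0) = x i 0.
Proof.
rewrite /dotp (bigD1 i)//= big1 ?addr0 => [|j ji].
  by rewrite mxE !eqxx mulr1.
by rewrite mxE (negbTE ji) mulr0.
Qed.

Lemma dotp_mul g x y : dotp (g *m x) y = dotp x (g^T *m y).
Proof. by rewrite !dotpE trmx_mul mulmxA. Qed.

Lemma orthogonal_invmx g : orthogonal_group R n g -> invmx g = g^T.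
Proof.
move=> gg; have [ug _] := mulmx1_unit gg.
by rewrite -[RHS](mulKmx ug) gg mulmx1.
Qed.

Lemma orthogonal_trmx g : orthogonal_group R n g -> orthogonal_group R n g^T.
Proof. by rewrite /orthogonal_group/= trmxK => /mulmx1C. Qed.

Lemma orthogonal_mulK g x : orthogonal_group R n g -> g *m (g^T *m x) = x.
Proof. by move=> gg; rewrite mulmxA gg mul1mx. Qed.

Lemma dotp_orthogonal g x y : orthogonal_group R n g ->
  dotp (g *m x) (g *m y) = dotp x y.
Proof.
move=> /orthogonal_trmx gg; rewrite dotp_mul -{2}(trmxK g).
by rewrite orthogonal_mulK.
Qed.

Lemma enorm_orthogonal g x : orthogonal_group R n g ->
  enorm (g *m x) = enorm x.
Proof. by move=> gg; rewrite /enorm dotp_orthogonal. Qed.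

Lemma orthogonalM g h : orthogonal_group R n g -> orthogonal_group R n h ->
  orthogonal_group R n (g *m h).
Proof.
rewrite /orthogonal_group/= => gg hh.
by rewrite trmx_mul mulmxA -(mulmxA g) hh mulmx1.
Qed.

Lemma special_orthogonalM g h : special_orthogonal_group R n g ->
  special_orthogonal_group R n h -> special_orthogonal_group R n (g *m h).
Proof.
move=> [og dg] [oh dh]; split; first exact: orthogonalM.
by rewrite det_mulmx dg dh mulr1.
Qed.

Lemma coord_le_norm x i : `|x i 0| <= `|x|.
Proof.
rewrite [`|x|](_ : _ = mx_norm x)// mx_normrE.
exact: (le_bigmax _ (fun ij : 'I_n * 'I_1 => `|x ij.1 ij.2|) (i, 0)).
Qed.

Lemma norm_le_coord x t : 0 <= t -> (forall i, `|x i 0| <= t) -> `|x| <= t.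
Proof.
move=> t0 xt; rewrite [`|x|](_ : _ = mx_norm x)// mx_normrE.
by apply/bigmax_leP; split=> // -[i j] _ /=; rewrite ord1.
Qed.

Lemma dotp_le_norm x y : `|dotp x y| <= n%:R * (`|x| * `|y|).
Proof.
rewrite /dotp (le_trans (ler_norm_sum _ _ _))//.
rewrite (_ : n%:R * _ = \sum_(i < n) (`|x| * `|y|)); last first.
  by rewrite sumr_const card_ord mulr_natl.
by apply: ler_sum => i _; rewrite normrM ler_pM// coord_le_norm.
Qed.

Lemma dotpxx_ge0 x : 0 <= dotp x x.
Proof. by apply: sumr_ge0 => i _; rewrite -expr2 sqr_ge0. Qed.

Lemma enorm_ge0 x : 0 <= enorm x.
Proof. exact: sqrtr_ge0. Qed.

Lemma sqr_enorm x : enorm x ^+ 2 = dotp x x.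
Proof. by rewrite sqr_sqrtr// dotpxx_ge0. Qed.

Lemma enormZ t x : enorm (t *: x) = `|t| * enorm x.
Proof.
rewrite /enorm dotpZl dotpZr mulrA -expr2 sqrtrM ?sqr_ge0//.
by rewrite sqrtr_sqr.
Qed.

Lemma enormN x : enorm (- x) = enorm x.
Proof. by rewrite -scaleN1r enormZ normrN1 mul1r. Qed.

Lemma norm_le_enorm x : `|x| <= enorm x.
Proof.
apply: norm_le_coord => [|i]; first exact: enorm_ge0.
rewrite -sqrtr_sqr ler_wsqrtr// /dotp (bigD1 i)//= -expr2 lerDl.
by apply: sumr_ge0 => j _; rewrite -expr2 sqr_ge0.
Qed.

Lemma enorm_le_norm x : enorm x <= n%:R * `|x|.
Proof.
rewrite -(ler_pXn2r (n := 2))// ?nnegrE ?enorm_ge0 ?mulr_ge0//.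
rewrite sqr_enorm (le_trans (ler_norm _))// (le_trans (dotp_le_norm _ _))//.
rewrite exprMn -expr2; have := sqr_ge0 `|x|; move: (`|x| ^+ 2) => a a0.
rewrite ler_wpM2r// -natrX ler_nat; case: (n) => // k.
by rewrite expnS leq_pmulr.
Qed.

Lemma continuous_dotp y : continuous (fun x : 'cV[R]_n => dotp x y).
Proof.
apply: (@continuous_big _ _ +%R 0) => [|i _]; first exact: add_continuous.
move=> x; have cx := @coord_continuous R n 1 i 0 x.
by apply: (@cvgM _ _ (nbhs x) _ (fun x : 'cV[R]_n => x i 0) (fun=> y i 0)) => //;
  exact: cvg_cst.
Qed.

(** The ball for the sup norm is a product of segments, transposed. *)
Lemma compact_norm_ball (r : R) : compact [set x : 'cV[R]_n | `|x| <= r].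
Proof.
have cT : continuous (fun x : 'rV[R]_n => x^T).
  move=> x A /nbhs_ballP[e e0 eA]; apply/nbhs_ballP; exists e => //= y [_ xy].
  by apply: eA; split => // i j; rewrite !mxE; exact: xy.
pose B := [set v : 'rV[R]_n | forall i, v ord0 i \in `[- r, r]].
have cB : compact B.
  apply: (@rV_compact _ _ (fun=> `[- r, r]%classic)) => _.
  exact: segment_compact.
have [r0|r0] := leP 0 r; last first.
  rewrite (_ : [set x | _] = set0); first exact: compact0.
  apply/seteqP; split=> // x /= xr.
  by have := lt_le_trans r0 (le_trans (normr_ge0 x) xr); rewrite ltxx.
rewrite (_ : [set x | _] = (fun x : 'rV[R]_n => x^T) @` B).
  apply: continuous_compact => //; exact: continuous_subspaceT.
apply/seteqP; split=> [x /= xr|_ [v Bv <-]].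
  exists x^T; last by rewrite trmxK.
  by move=> i; rewrite mxE in_itv/= -ler_norml (le_trans (coord_le_norm _ _)).
by apply: norm_le_coord => // i; have := Bv i; rewrite in_itv/= -ler_norml mxE.
Qed.

End geometry.

(** * Suprema of affine functions *)

Section functions.
Context {R : realType} {n : nat}.
Implicit Types (f v psi : 'cV[R]_n -> \bar R) (Y : set 'cV[R]_n).
Implicit Types x y z : 'cV[R]_n.

Lemma lsc_nearP f : lower_semicontinuous f <->
  forall x (a : R), a%:E < f x -> \forall y \near x, a%:E < f y.
Proof.
split=> lsc x a afx; first by have [V xV Vf] := lsc x a afx; exact: filterS xV.
by exists [set y | a%:E < f y] => //; exact: lsc.
Qed.

Lemma coercive_normP f : coercive f <->
  forall M : R, exists K : R, forall x, (K < `|x|)%R -> M%:E < f x.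
Proof.
split=> cf M; have [K fK] := cf M.
  by exists K => x Kx; apply: fK; apply: lt_le_trans Kx (norm_le_enorm x).
(* The maximum with 0 takes care of the factor n for negative K. *)
exists (n%:R * Num.max K 0)%R => x Kx; apply: fK.
have := lt_le_trans Kx (enorm_le_norm x); move: `|x|%R => r.
have [->|n0] := eqVneq n 0%N; first by rewrite !mul0r ltxx.
by rewrite ltr_pM2l ?ltr0n ?lt0n//; apply: le_lt_trans; rewrite le_max lexx.
Qed.

(** Convexity of infima (epi-sums) is easiest to check on real upper bounds,
    since an infimum below a real number is undercut by some competitor. *)
Lemma econvex_level f : (forall x, f x != -oo) ->
  (forall x y (t a b : R), (0 < t < 1)%R -> f x < a%:E -> f y < b%:E ->
    f (t *: x + (1 - t) *: y)%R <= (t * a + (1 - t) * b)%:E) -> econvex f.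
Proof.
move=> fNy fab x y t t01; have /andP[t0 t1] := t01.
have t1' : (0 < 1 - t)%R by rewrite subr_gt0.
have := fNy x; have := fNy y; case fx: (f x) => [a| |]// ; last first.
  move=> fy _; rewrite gt0_muley ?lte_fin// addye ?leey//.
  by case: (f y) fy => // *; rewrite -?EFinM// gt0_muley ?lte_fin.
case fy: (f y) => [b| |]// _ _; last first.
  by rewrite gt0_muley ?lte_fin// addey ?leey// -EFinM.
apply/lee_addgt0Pr => e e0; rewrite -!EFinM -EFinD.
have -> : (t * a + (1 - t) * b + e = t * (a + e) + (1 - t) * (b + e))%R by ring.
by apply: fab; rewrite ?fx ?fy// lte_fin ltrDl.
Qed.

(** The value [v y = +oo] discards the slope [y]; [legendre psi] is the case where
    [Y] is the whole space. *)
Definition affine_sup v Y : 'cV[R]_n -> \bar R :=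
  fun x => ereal_sup [set (dotp x y)%:E - v y | y in Y].

Lemma affine_sup_ge v Y x y : Y y -> (dotp x y)%:E - v y <= affine_sup v Y x.
Proof. by move=> Yy; apply: ereal_sup_ubound; exists y. Qed.

Lemma affine_sup_leP v Y x M :
  affine_sup v Y x <= M <-> (forall y, Y y -> (dotp x y)%:E - v y <= M).
Proof.
split=> [vM y Yy|vM]; first exact: le_trans (affine_sup_ge _ _ Yy) vM.
by apply/ereal_supP => _ [y Yy <-]; exact: vM.
Qed.

Lemma dotp_near_gt x y (a : R) : (a < dotp x y)%R ->
  \forall x' \near x, (a < dotp x' y)%R.
Proof. by move=> ax; apply: (cvgr_gt _ (@continuous_dotp R n y x)). Qed.

Lemma lsc_affine_sup v Y : lower_semicontinuous (affine_sup v Y).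
Proof.
apply/lsc_nearP => x a /ereal_sup_gtP[_ [y Yy <-]].
case vy: (v y) => [b| |]//.
- rewrite -EFinB lte_fin ltrBrDr => /dotp_near_gt; apply: (@filterS _ (nbhs x)) => x' ax'.
  apply: lt_le_trans (affine_sup_ge _ _ Yy).
  by rewrite vy -EFinB lte_fin ltrBrDr.
- move=> _; apply: (@filterE _ (nbhs x)) => x'; apply: lt_le_trans (affine_sup_ge _ _ Yy).
  by rewrite vy ltry.
Qed.

Lemma econvex_affine_sup v Y : econvex (affine_sup v Y).
Proof.
move=> x x' t /andP[t0 t1]; apply/affine_sup_leP => y Yy.
have t1' : (0 < 1 - t)%R by rewrite subr_gt0.
apply: (@le_trans _ _ (t%:E * ((dotp x y)%:E - v y) +
                       (1 - t)%:E * ((dotp x' y)%:E - v y))); last first.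
  by apply: leeD; (apply: lee_wpmul2l; [rewrite lee_fin ltW|exact: affine_sup_ge]).
case: (v y) => [b| |].
- by rewrite -!EFinB -!EFinM -EFinD lee_fin dotpDl !dotpZl; nra.
- by rewrite leNye.
- by rewrite /= !addey// !gt0_muley ?lte_fin.
Qed.

Lemma pos_nonempty Y z : pos Y z -> z != 0%R -> Y !=set0.
Proof.
move=> [[|k] [a [u [au ->]]]]; first by rewrite big_ord0 eqxx.
by exists (u ord0); exact: (au ord0).2.
Qed.

(** A point of the positive hull is a nonnegative combination of slopes, and on a
    sublevel set of the supremum each slope has a bounded pairing with [x]. *)
Lemma pos_sublevel_bounded v Y z : (forall y, Y y -> v y < +oo) ->
  pos Y z -> forall M : R, exists C : R, forall x,
  affine_sup v Y x <= M%:E -> (dotp x z <= C)%R.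
Proof.
move=> vfin [k [a [u [au ->]]]] M.
exists (\sum_(i < k) a i * (M + fine (v (u i))))%R => x xM.
rewrite dotp_sumr; apply: ler_sum => i _; rewrite dotpZr.
have [ai Yu] := au i; apply: ler_wpM2l => //.
have := le_trans (affine_sup_ge _ x Yu) xM; have := vfin _ Yu.
by case: (v (u i)) => [b| |]//= _; rewrite -EFinB lee_fin lerBlDr.
Qed.

(** Only the signed unit vectors need to be in the positive hull; this weaker form
    of spanning passes to finite subfamilies of slopes. *)
Lemma coercive_affine_sup v Y : (forall y, Y y -> v y < +oo) ->
  (forall i (b : bool), pos Y ((-1) ^+ b *: delta_mx i 0)%R) ->
  coercive (affine_sup v Y).
Proof.
move=> vfin posY; apply/coercive_normP => M.
have /choice[C HC] : forall ib : 'I_n * bool, exists C : R, forall x,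
    affine_sup v Y x <= M%:E -> (dotp x ((-1) ^+ ib.2 *: delta_mx ib.1 0) <= C)%R.
  by move=> [i b]; exact: pos_sublevel_bounded.
exists (\sum_ib `|C ib|)%R => x; rewrite !ltNge; apply: contra => xM.
apply: norm_le_coord => [|i]; first exact: sumr_ge0.
have CC ib : (C ib <= \sum_ib `|C ib|)%R.
  by rewrite (bigD1 ib)//= (le_trans (ler_norm _))// lerDl sumr_ge0.
have := HC (i, true) x xM; have := HC (i, false) x xM.
rewrite /= expr0 expr1 !dotpZr dotp_delta mul1r mulN1r => xi xNi.
by rewrite ler_norml lerNl (le_trans xi)// (le_trans xNi).
Qed.

End functions.

Section Conv_c_affine_sup.
Context {R : realType} {n : nat} (n_gt0 : (0 < n)%N).
Implicit Types (v : 'cV[R]_n -> \bar R) (Y : set 'cV[R]_n).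

Lemma affine_supS v Y Y' x : Y `<=` Y' -> affine_sup v Y x <= affine_sup v Y' x.
Proof.
by move=> YY'; apply/affine_sup_leP => y Yy; apply: affine_sup_ge; exact: YY'.
Qed.

Lemma Conv_c_affine_sup v Y Yo : Yo `<=` Y -> (forall y, Yo y -> v y < +oo) ->
  (forall i (b : bool), pos Yo ((-1) ^+ b *: delta_mx i 0)%R) ->
  (exists x, affine_sup v Y x != +oo) -> Conv_c R n (affine_sup v Y).
Proof.
move=> YoY vfin posYo vproper.
have [y0 Yoy0] : Yo !=set0.
  apply: (pos_nonempty (posYo (Ordinal n_gt0) false)).
  rewrite expr0 scale1r; apply/eqP => /matrixP/(_ (Ordinal n_gt0) 0%R).
  by rewrite !mxE !eqxx => /eqP; rewrite oner_eq0.
split => //.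
- move=> x; rewrite -ltNye.
  apply: lt_le_trans (affine_sup_ge _ _ (YoY _ Yoy0)).
  by have := vfin _ Yoy0; case: (v y0) => [b| |]//= _; rewrite -EFinB ltNyr.
- exact: econvex_affine_sup.
- exact: lsc_affine_sup.
- move=> M; have [K KM] := coercive_affine_sup vfin posYo M.
  by exists K => x /KM Mx; exact: lt_le_trans Mx (affine_supS _ _ _).
Qed.

End Conv_c_affine_sup.

(** * Stability of Conv_c under epi-addition and epi-multiplication *)

Section ereal_facts.
Context {R : realType}.
Implicit Types (u w : \bar R) (a b : R).

Lemma ereal_real_between a u : a%:E < u -> exists2 b : R, (a < b)%R & b%:E < u.
Proof.
case: u => [r| |]//; last by exists (a + 1)%R; rewrite ?ltry// ltrDl.
by rewrite lte_fin => ar; exists ((a + r) / 2)%R; rewrite ?lte_fin; lra.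
Qed.

Lemma ereal_lt_add_split b u w : u != -oo -> w != -oo -> b%:E < u + w ->
  exists c d : R, [/\ c%:E < u, d%:E < w & (b <= c + d)%R].
Proof.
case: u => [r| |]// _; case: w => [s| |]// _.
- rewrite -EFinD lte_fin => brs.
  exists (r - (r + s - b) / 2)%R, (s - (r + s - b) / 2)%R.
  by rewrite !lte_fin; split; lra.
- move=> _; exists (r - 1)%R, (b - r + 1)%R.
  by rewrite lte_fin ltry; split => //; lra.
- move=> _; exists (b - s + 1)%R, (s - 1)%R.
  by rewrite lte_fin ltry; split => //; lra.
- by exists 0%R, b; rewrite !ltry; split => //; lra.
Qed.

Lemma ereal_add_lt_real b u w : u != -oo -> w != -oo -> u + w < b%:E ->
  exists p q : R, [/\ u = p%:E, w = q%:E & (p + q < b)%R].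
Proof.
by case: u => [p| |]// _; case: w => [q| |]// _ pq; exists p, q.
Qed.

End ereal_facts.

Section Conv_c_closure.
Context {R : realType} {n : nat}.
Implicit Types f g : 'cV[R]_n -> \bar R.
Implicit Types x y z : 'cV[R]_n.

(** Coercivity bounds the function outside a ball, and lower semicontinuity on the
    compact ball. *)
Lemma Conv_c_bounded_below f : Conv_c R n f -> exists m : R, forall x, m%:E <= f x.
Proof.
move=> [fNy _ _ /lsc_nearP lscf /coercive_normP/(_ 0%R)[K fK]].
have := @compact_norm_ball R n K => /compact_near_coveringP cK.
have := cK nat \oo (fun N x => (- N%:R)%:E < f x) _.
case.
  move=> x _; have [N Nf] : exists N : nat, (- N%:R)%:E < f x.
    have := fNy x; case: (f x) => [r| |]// _; last by exists 0%N; rewrite ltry.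
    exists (Num.bound `|r|%R); rewrite lte_fin ltrNl.
    by apply: le_lt_trans (archi_boundP (normr_ge0 r)); rewrite -normrN ler_norm.
  exists ([set x' | (- N%:R)%:E < f x'], [set M | (N <= M)%N]).
    by split; [exact: lscf|exists N].
  move=> [x' M] /= [fx' NM]; apply: le_lt_trans fx'.
  by rewrite lee_fin lerN2 ler_nat.
move=> N _ /(_ N (leqnn N)) fN; exists (- N%:R)%R => x.
have [xK|Kx] := leP `|x|%R K; first exact/ltW/fN.
by apply: le_trans (ltW (fK _ Kx)); rewrite lee_fin oppr_le0.
Qed.

Lemma epi_sum_leP f g x y : epi_sum f g x <= f (x - y)%R + g y.
Proof. by apply: ereal_inf_lbound; exists y. Qed.

(** Lower semicontinuity of the infimum holds because the competitors [y] can be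
    confined to a compact ball: outside it [g] is large and [f] is bounded below. *)
Lemma Conv_c_epi_sum f g : Conv_c R n f -> Conv_c R n g -> Conv_c R n (epi_sum f g).
Proof.
move=> cf cg; have [mf fm] := Conv_c_bounded_below cf.
have [mg gm] := Conv_c_bounded_below cg.
case: cf => fNy fconv [x0 fx0] /lsc_nearP flsc /coercive_normP fcoer.
case: cg => gNy gconv [y0 gy0] /lsc_nearP glsc /coercive_normP gcoer.
have fgNy x : epi_sum f g x != -oo.
  rewrite -ltNye (@lt_le_trans _ _ (mf + mg)%:E) ?ltNyr//.
  by apply/ereal_infP => _ [y _ <-]; rewrite EFinD leeD.
split => //.
- apply: econvex_level => // x x' t a a' t01.
  move=> /ereal_inf_ltP[_ [y _ <-] /ereal_add_lt_real].
  move=> /(_ (fNy _) (gNy _))[p [q [fp gq pq]]].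
  move=> /ereal_inf_ltP[_ [y' _ <-] /ereal_add_lt_real].
  move=> /(_ (fNy _) (gNy _))[p' [q' [fp' gq' pq']]].
  apply: le_trans (epi_sum_leP _ _ _ (t *: y + (1 - t) *: y')%R) _.
  have -> : (t *: x + (1 - t) *: x' - (t *: y + (1 - t) *: y') =
             t *: (x - y) + (1 - t) *: (x' - y'))%R.
    by rewrite !scalerBr opprD addrACA.
  apply: le_trans (leeD (fconv _ _ _ t01) (gconv _ _ _ t01)) _.
  rewrite fp fp' gq gq' -!EFinM -!EFinD lee_fin.
  by case/andP: t01 => t0 t1; nra.
- exists (x0 + y0)%R; rewrite -ltey.
  apply: le_lt_trans (epi_sum_leP _ _ _ y0) _.
  by rewrite addrK lte_add_pinfty// ltey.
- apply/lsc_nearP => x a /ereal_real_between[b ab bfg].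
  have [K gK] := gcoer (b - mf)%R.
  have := @compact_norm_ball R n K => /compact_near_coveringP cK.
  have nx : \forall x' \near x, [set y : 'cV[R]_n | (`|y| <= K)%R] `<=`
      [set y | b%:E < f (x' - y)%R + g y].
    apply: (cK _ (nbhs x) (fun x' y => b%:E < f (x' - y)%R + g y)) => y _.
    have : b%:E < f (x - y)%R + g y by apply: lt_le_trans bfg (epi_sum_leP _ _ _ _).
    move=> /(ereal_lt_add_split (fNy _) (gNy _))[c [d [fc gd bcd]]].
    have cvxy : (z.2 - z.1)%R @[z --> (y, x)] --> (x - y)%R.
      by apply: cvgB; [exact: cvg_snd|exact: cvg_fst].
    have near_f : \forall z \near (y, x), c%:E < f (z.2 - z.1)%R.
      exact: (cvxy _ (flsc _ _ fc)).
    have near_g : \forall z \near (y, x), d%:E < g z.1.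
      by have := glsc _ _ gd; exact: cvg_fst.
    have [[A B] [yA xB] AB] := filterI near_f near_g.
    exists (A, B) => // -[y' x'] /AB[/= fc' gd'].
    by apply: le_lt_trans (lteD fc' gd'); rewrite -EFinD lee_fin.
  apply: filterS nx => x' Vfg.
  apply: (@lt_le_trans _ _ b%:E); first by rewrite lte_fin.
  apply/ereal_infP => _ [y _ <-]; have [yK|Ky] := leP `|y|%R K; first exact/ltW/Vfg.
  by have := leeD (fm (x' - y)%R) (ltW (gK _ Ky)); rewrite -EFinD addrC subrK.
- apply/coercive_normP => M.
  have [Kf fK] := fcoer (M + 1 - mg)%R; have [Kg gK] := gcoer (M + 1 - mf)%R.
  exists (Kf + Kg)%R => x Kx.
  apply: (@lt_le_trans _ _ (M + 1)%:E); first by rewrite lte_fin ltrDl.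
  apply/ereal_infP => _ [y _ <-].
  have [xyK|Kxy] := leP `|x - y|%R Kf; last first.
    by have := leeD (ltW (fK _ Kxy)) (gm y); rewrite -EFinD subrK.
  have Ky : (Kg < `|y|)%R.
    rewrite ltNge; apply/negP => yK; move: Kx; rewrite ltNge => /negP; apply.
    by rewrite -(subrK y x) (le_trans (ler_normD _ _))// lerD.
  by have := leeD (fm (x - y)%R) (ltW (gK _ Ky)); rewrite -EFinD addrCA subrr addr0.
Qed.

Lemma Conv_c_epi_mul (l : R) f : (0 < l)%R -> Conv_c R n f -> Conv_c R n (epi_mul l f).
Proof.
move=> l0 [fNy fconv [x0 fx0] /lsc_nearP flsc /coercive_normP fcoer].
have lV0 : (0 < l^-1)%R by rewrite invr_gt0.
have mulNy u : u != -oo -> l%:E * u != -oo.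
  by case: u => [r| |]// _; rewrite ?gt0_muley ?lte_fin.
have ltmul (a : R) u : (a%:E < l%:E * u) = ((l^-1 * a)%:E < u).
  by rewrite EFinM -[in RHS]lte_pdivlMl// invrK.
have mullt (a : R) u : (l%:E * u < a%:E) = (u < (l^-1 * a)%:E).
  by rewrite EFinM lte_pdivlMl.
split.
- by move=> x; exact: mulNy.
- apply: econvex_level => [x|x y t a b t01]; first exact: mulNy.
  rewrite /epi_mul !mullt => /ltW fa /ltW fb.
  have /andP[/ltW t0 t1] := t01.
  rewrite scalerDr 2!scalerA [(l^-1 * t)%R]mulrC [(l^-1 * (1 - t))%R]mulrC -2!scalerA.
  apply: le_trans (lee_wpmul2l _ (fconv _ _ _ t01)) _; first by rewrite lee_fin ltW.
  apply: (@le_trans _ _ (l%:E * (t%:E * (l^-1 * a)%:E + (1 - t)%:E * (l^-1 * b)%:E))).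
    apply: lee_wpmul2l; first by rewrite lee_fin ltW.
    by apply: leeD; apply: lee_wpmul2l => //; rewrite lee_fin// subr_ge0 ltW.
  rewrite -!EFinM lee_fin.
  by rewrite le_eqVlt; apply/orP; left; apply/eqP; field; rewrite gt_eqF.
- exists (l *: x0)%R; rewrite /epi_mul scalerA (mulVf (lt0r_neq0 l0)) scale1r.
  by move: fx0 (fNy x0); case: (f x0) => [r| |]// _ _; rewrite -EFinM.
- apply/lsc_nearP => x a; rewrite /epi_mul ltmul => /flsc fx.
  have cx : (l^-1 *: x')%R @[x' --> x] --> (l^-1 *: x)%R.
    by apply: (@cvgZl_tmp _ _ _ (nbhs x) _ (l^-1)%R id x); exact: cvg_id.
  have nx : \forall x' \near x, (l^-1 * a)%:E < f (l^-1 *: x')%R by exact: (cx _ fx).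
  by apply: filterS nx => x'; rewrite ltmul.
- apply/coercive_normP => M; have [K fK] := fcoer (l^-1 * M)%R.
  exists (l * K)%R => x Kx; rewrite /epi_mul ltmul; apply: fK.
  by rewrite normrZ gtr0_norm// mulrC ltr_pdivlMr// mulrC.
Qed.

End Conv_c_closure.

(** * Legendre transforms and the inner radius *)

Section legendre.
Context {R : realType} {n : nat}.
Implicit Types (p psi : 'cV[R]_n -> \bar R) (Y : set 'cV[R]_n).
Implicit Types x y z : 'cV[R]_n.

Lemma legendre_ge p x y : (dotp x y)%:E - p y <= legendre p x.
Proof. exact: affine_sup_ge. Qed.

Lemma legendre_proper_gt p x y : p x != +oo -> -oo < legendre p y.
Proof.
move=> px; apply: lt_le_trans (legendre_ge p y x).
by move: px; case: (p x) => [r| |]//= _; rewrite -?EFinB ltNyr.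
Qed.

(** The supremum of the admissible constants is attained at minus the transform;
    both sides are [-oo] when [p] has no affine minorant of slope [y]. *)
Lemma support_constE p x y : p x != +oo -> support_const p y = - legendre p y.
Proof.
move=> px; apply/eqP; rewrite eq_le; apply/andP; split.
  apply/ereal_supP => c [cy cp]; rewrite leeNr; apply/affine_sup_leP => z _.
  have := cp z; rewrite dotpC.
  case: c cy {cp} => [c| |]//= _; last by rewrite leey.
  case: (p z) => [q| |]//=; rewrite ?leNye// -?EFinB -?EFinD ?lee_fin; lra.
apply: ereal_sup_ubound; split.
  by rewrite lteNl; exact: legendre_proper_gt px.
move=> z; have := legendre_ge p y z; rewrite dotpC.
case: (legendre p y) => [l| |]//=; rewrite ?leNye//.
  by case: (p z) => [q| |]//=; rewrite ?leey -?EFinB -?EFinD ?lee_fin//; lra.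
by case: (p z) => [q| |]//=; rewrite leey.
Qed.

Lemma outer_linE p Y x : p x != +oo ->
  outer_lin p Y = affine_sup (legendre p) Y.
Proof.
move=> px; apply/funext => z; congr ereal_sup; apply: eq_imagel => y _.
by rewrite /support_fun (support_constE y px).
Qed.

Lemma legendre_rotate p g y : orthogonal_group R n g ->
  legendre (rotate g p) y = legendre p (invmx g *m y)%R.
Proof.
move=> og; have og' := orthogonal_trmx og; have gV := orthogonal_invmx og.
rewrite gV; apply/eqP; rewrite eq_le; apply/andP; split.
  apply/affine_sup_leP => x _; rewrite /rotate gV.
  apply: le_trans (legendre_ge p _ (g^T *m x)%R).
  by rewrite dotp_orthogonal.
apply/affine_sup_leP => x _.
apply: le_trans (legendre_ge _ _ (g *m x)%R).
rewrite /rotate gV dotp_mul trmxK.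
by have := orthogonal_mulK x og'; rewrite trmxK => ->.
Qed.

Lemma legendre_lower_bound p x0 (q : R) : p x0 = q%:E ->
  forall r : R, exists C : R, forall z, (enorm z <= r)%R -> (- C)%:E <= legendre p z.
Proof.
move=> px r; exists (n%:R * (r * `|x0|) + q)%R => z zr.
apply: le_trans (legendre_ge p z x0); rewrite px -EFinB lee_fin.
rewrite opprD lerD2r lerNl (le_trans (ler_norm _))// normrN.
rewrite (le_trans (dotp_le_norm _ _))// ler_wpM2l// ler_wpM2r//.
exact: le_trans (norm_le_enorm _) zr.
Qed.

Lemma compact_enorm_ball (r : R) : compact [set x : 'cV[R]_n | (enorm x <= r)%R].
Proof.
have [r0|r0] := ltP r 0%R.
  rewrite (_ : [set x | _] = set0); first exact: compact0.
  apply/seteqP; split=> // x /= xr.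
  by have := lt_le_trans r0 (le_trans (enorm_ge0 x) xr); rewrite ltxx.
apply: (subclosed_compact _ (@compact_norm_ball R n r)); last first.
  by move=> x /= xr; exact: le_trans (norm_le_enorm x) xr.
have cd : continuous (fun x : 'cV[R]_n => dotp x x).
  apply: (@continuous_big _ _ +%R 0%R) => [|i _]; first exact: add_continuous.
  move=> x; have cx := @coord_continuous R n 1 i 0%R x.
  exact: (@cvgM _ _ (nbhs x) _ (fun x : 'cV[R]_n => x i 0%R) (fun x => x i 0%R)).
rewrite (_ : [set x | _] = (fun x => dotp x x) @^-1` [set t | (t <= r ^+ 2)%R]).
  by apply: closed_comp => [x _|]; [exact: cd|exact: closed_le].
apply/seteqP; split=> x /=; rewrite -sqr_enorm ler_pXn2r// ?nnegrE ?enorm_ge0//.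
Qed.

(** For [y] with largest coordinate in position [i], the pairing of a small [w] with
    [y] is at most that of [s] times the signed unit vector in direction [i], so the
    finitely many values of the transform at these vectors bound it near 0. *)
Lemma legendre_bounded_near0 p (s : R) : (0 < s)%R ->
  (forall z, (enorm z <= s)%R -> legendre p z < +oo) ->
  exists M : R, forall w, (n%:R * `|w| <= s)%R -> legendre p w <= M%:E.
Proof.
move=> s0 pfin.
pose u (ib : 'I_n * bool) : 'cV[R]_n := (s *: ((-1) ^+ ib.2 *: delta_mx ib.1 0))%R.
have us ib : (enorm (u ib) <= s)%R.
  rewrite /u !enormZ normrX normrN1 expr1n mul1r gtr0_norm//.
  rewrite -[leRHS]mulr1 ler_pM2l// /enorm dotp_delta mxE !eqxx.
  by rewrite /= sqrtr1.
have bound z : (enorm z <= s)%R -> exists c : R, legendre p z <= c%:E.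
  move/pfin; case: (legendre p z) => [c| |]// _; first by exists c.
  by exists 0%R; rewrite leNye.
have /choice[c cu] ib := bound _ (us ib).
have [c0 pc0] : exists c : R, legendre p 0%R <= c%:E.
  by apply: bound; rewrite -(scale0r 0%R) enormZ normr0 mul0r ltW.
exists (`|c0| + \sum_ib `|c ib|)%R => w ws; apply/affine_sup_leP => y _.
have sum_ge0 : (0 <= \sum_ib `|c ib|)%R by apply: sumr_ge0.
have [y0|y0] := eqVneq y 0%R.
  apply: le_trans (le_trans (legendre_ge p 0%R y) (le_trans pc0 _)).
    by rewrite y0 !(dotpC _ 0%R) -(scale0r 0%R) !dotpZl !mul0r.
  by rewrite lee_fin (le_trans (ler_norm _))// lerDl.
have [[i j] /= yi] : exists ij, mx_norm y = `|y ij.1 ij.2|%R.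
  by apply: mx_norm_neq0; apply: contra y0 => /eqP/mx_norm_eq0/eqP.
rewrite {j}(ord1 j) in yi.
pose ib := (i, (y i 0 < 0)%R).
have dy : (dotp (u ib) y = s * `|y|)%R.
  rewrite /u !dotpZl dotpC dotp_delta /= [in RHS](_ : `|y| = mx_norm y)%R// yi.
  by case: ltrgt0P => //= h; rewrite ?expr1 ?expr0 ?mulN1r ?mul1r// h mulr0.
apply: (@le_trans _ _ ((dotp (u ib) y)%:E - p y)).
  apply: leeD => //; rewrite lee_fin dy (le_trans (ler_norm _))//.
  by rewrite (le_trans (dotp_le_norm _ _))// mulrA ler_wpM2r.
apply: le_trans (le_trans (legendre_ge p (u ib) y) (le_trans (cu ib) _)) => //.
rewrite lee_fin (le_trans (ler_norm _))// (bigD1 ib)//= addrCA lerDl.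
by rewrite addr_ge0// sumr_ge0.
Qed.

(** Pointwise finiteness on the larger ball gives boundedness on the smaller one.
    Near a point [z0] of the smaller ball, write [z] as a convex combination of a
    dilate of [z0] that is still in the larger ball and of a vector close to 0;
    convexity bounds the transform near [z0], and compactness concludes. *)
Lemma legendre_bounded p (r s : R) : (0 <= r < s)%R ->
  (forall z, (enorm z <= s)%R -> legendre p z < +oo) ->
  exists M : R, forall z, (enorm z <= r)%R -> legendre p z <= M%:E.
Proof.
move=> /andP[r0 rs] pfin; have s0 : (0 < s)%R by exact: le_lt_trans rs.
have [M0 pM0] := legendre_bounded_near0 s0 pfin.
(* Midway between r / s and 1: dividing the smaller ball by t stays in the larger. *)
pose t := ((r + s) / (2 * s))%R.
have st : (s * t = (r + s) / 2)%R by rewrite /t; field; exact: lt0r_neq0.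
have t0 : (0 < t)%R by rewrite divr_gt0//; lra.
have t1 : (t < 1)%R by rewrite ltr_pdivrMr; lra.
have cr := iffLR (compact_near_coveringP _) (@compact_enorm_ball r).
have [N _ HN] : \forall N \near \oo, [set z : 'cV[R]_n | (enorm z <= r)%R] `<=`
    [set z | legendre p z <= N%:R%:E].
  apply: (cr nat \oo (fun N z => legendre p z <= N%:R%:E)) => z0 /= z0r.
  have uz : (enorm (t^-1 *: z0) <= s)%R.
    rewrite enormZ gtr0_norm ?invr_gt0// mulrC ler_pdivrMr// (le_trans z0r)//.
    by rewrite st; lra.
  have [c pc] : exists c : R, legendre p (t^-1 *: z0)%R <= c%:E.
    have := pfin _ uz; case: (legendre p _) => [c| |]// _; first by exists c.
    by exists 0%R; rewrite leNye.
  (* With n.+1 in place of n the radius makes sense for n = 0 as well. *)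
  pose e := (s * (1 - t) / n.+1%:R)%R.
  have e0 : (0 < e)%R by rewrite divr_gt0 ?mulr_gt0// subr_gt0.
  exists (ball z0 e, [set N | (Num.bound (`|c| + `|M0|) <= N)%N]).
    by split; [exact: nbhsx_ballx|exists (Num.bound (`|c| + `|M0|))].
  move=> [z N] /= [+ cN]; rewrite -ball_normE /ball_/= => zz0.
  pose w := ((1 - t)^-1 *: (z - z0))%R.
  have -> : z = (t *: (t^-1 *: z0) + (1 - t) *: w)%R.
    by rewrite /w !scalerA !mulfV ?gt_eqF ?subr_gt0// !scale1r addrC subrK.
  have pw : legendre p w <= M0%:E.
    apply: pM0; rewrite /w normrZ gtr0_norm ?invr_gt0 ?subr_gt0//.
    rewrite mulrCA mulrC ler_pdivrMr ?subr_gt0//.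
    move: zz0; rewrite distrC; have := normr_ge0 (z - z0)%R.
    move: `|z - z0|%R => d d0.
    by rewrite ltr_pdivlMr// -natr1 mulrDr mulr1 mulrC => dn; rewrite -[leLHS]addr0; lra.
  have t01 : (0 < t < 1)%R by rewrite t0.
  apply: le_trans (econvex_affine_sup _ _ _ _ t01) _.
  apply: (@le_trans _ _ (t%:E * c%:E + (1 - t)%:E * M0%:E)).
    by apply: leeD; (apply: lee_wpmul2l; [rewrite lee_fin; lra|by []]).
  rewrite -!EFinM -EFinD lee_fin.
  apply: (@le_trans _ _ (`|c| + `|M0|)%R).
    have := ler_norm c; have := ler_norm M0.
    have := normr_ge0 c; have := normr_ge0 M0; nra.
  apply: (le_trans (ltW (archi_boundP _))); first by rewrite addr_ge0.
  by rewrite ler_nat.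
by exists N%:R => z zr; exact: (HN N (leqnn N)).
Qed.

End legendre.

Section admissible_slopes.
Context {R : realType} {n : nat} (n_gt0 : (0 < n)%N).
Implicit Types (psi : 'cV[R]_n -> \bar R) (Y : set 'cV[R]_n).

(** The interior is strict because a point can be pushed outwards along a unit
    vector having a nonnegative pairing with it. *)
Lemma interior_dilated_ball (r : \bar R) (y : 'cV[R]_n) :
  0 <= r -> interior (dilated_ball r) y -> (enorm y)%:E < r.
Proof.
case: r => [r| |]//; last by rewrite ltry.
move=> r0 /nbhs_ballP[e /= e0 er]; rewrite lte_fin.
have [w w1 yw] : exists2 w : 'cV[R]_n, dotp w w = 1%R & (0 <= dotp y w)%R.
  pose i := Ordinal n_gt0.
  exists ((-1) ^+ (y i 0 < 0)%R *: delta_mx i 0)%R.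
    rewrite dotpZl dotpZr dotp_delta mxE !eqxx mulr1 -expr2 -exprM mulnC exprM.
    by rewrite sqrrN expr1n expr1n.
  rewrite dotpZr dotp_delta.
  by case: ltP => h; rewrite ?expr1 ?expr0 ?mulN1r ?mul1r// oppr_ge0 ltW.
have : ball y e (y + (e / 2) *: w)%R.
  rewrite -ball_normE /ball_/= opprD addrA subrr add0r normrN normrZ.
  rewrite gtr0_norm ?divr_gt0//.
  have : (`|w| <= 1)%R by rewrite (le_trans (norm_le_enorm _))// /enorm w1 sqrtr1.
  by move=> w1'; nra.
move=> /er[x]; rewrite /unit_ball/= => x1 xE.
have : (enorm (y + (e / 2) *: w) <= r)%R.
  by rewrite -xE enormZ ger0_norm// ler_piMr.
apply: lt_le_trans.
rewrite -(ltr_pXn2r (n := 2))// ?nnegrE ?enorm_ge0// !sqr_enorm.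
rewrite dotpDl !dotpDr !dotpZl !dotpZr w1 (dotpC w).
by nra.
Qed.

Lemma interior_inner_radius psi (y : 'cV[R]_n) :
  interior (dilated_ball (inner_radius psi)) y ->
  exists2 s : R, (enorm y < s)%R &
    forall z, (enorm z <= s)%R -> legendre psi z < +oo.
Proof.
move=> yint; have /interior_dilated_ball/(_ yint) : 0 <= inner_radius psi.
  apply: contrapT => /negP; rewrite -ltNge => r0; move: yint.
  suff -> : inner_radius psi = -oo by move=> /interior_subset.
  apply/ereal_sup_ninfty => _ [r [rge0 rdom] <-] /=; exfalso.
  have : r%:E <= inner_radius psi by apply: ereal_sup_ubound; exists r.
  by move=> /le_lt_trans/(_ r0); rewrite lte_fin ltNge rge0.
move=> /ereal_sup_gtP[_ [s [s0 sdom] <-]]; rewrite lte_fin => ys.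
exists s => // z zs; apply: sdom => /=.
have sgt0 : (0 < s)%R := le_lt_trans (enorm_ge0 y) ys.
exists (s^-1 *: z)%R; last by rewrite scalerA mulfV ?gt_eqF// scale1r.
by rewrite /unit_ball/= enormZ gtr0_norm ?invr_gt0// mulrC ler_pdivrMr// mul1r.
Qed.

End admissible_slopes.

(** * Finite averages approximating an integral *)

Section approachability.
Context {R : realType} {I : finType}.
Implicit Types (u w p : I -> R) (U : set (I -> R)).
Local Open Scope ring_scope.

Lemma max0_sqr_le (a b : R) : a <= b -> Num.max 0 a ^+ 2 <= b ^+ 2.
Proof.
move=> ab; have [a0|a0] := leP 0 a; last by rewrite expr0n/= sqr_ge0.
by rewrite ler_pXn2r// nnegrE; exact: le_trans ab.
Qed.

(** Blackwell's approachability argument.  Let [u] be the average of the first [m]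
    points chosen, and [w] the positive part of [u - p].  Choosing the next
    point [u'] with nonpositive [w]-weighted sum of [u' - p] makes the cross term
    in the squared distance nonpositive, so that the squared distance from [m u] to
    the orthant [{m p - t | t >= 0}] grows at most linearly in [m]. *)
Lemma approachability U p (K : R) :
  (forall u1 u2 t, U u1 -> U u2 -> 0 < t < 1 ->
     U (fun i => t * u1 i + (1 - t) * u2 i)) ->
  (forall w, (forall i, 0 <= w i) -> 0 < \sum_i w i ->
     exists2 u, U u & (forall i, `|u i - p i| <= K) /\
                      \sum_i w i * (u i - p i) <= 0) ->
  (0 < #|I|)%N ->
  forall e, 0 < e -> exists2 u, U u & forall i, u i <= p i + e.
Proof.
move=> Uconv Uw I0 e e0.
pose C := #|I|%:R * K ^+ 2.
have C0 : 0 <= C by rewrite mulr_ge0// sqr_ge0.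
have sumK a : (forall i : I, `|a i| <= K) -> \sum_i a i ^+ 2 <= C.
  move=> aK; rewrite /C mulr_natl -sumr_const; apply: ler_sum => i _.
  have K0 := le_trans (normr_ge0 (a i)) (aK i).
  by rewrite -(real_normK (num_real _)) ler_pXn2r.
have main m : exists2 u, U u &
    \sum_i Num.max 0 (u i - p i) ^+ 2 <= C / m.+1%:R.
  elim: m => [|m [u Uu IH]].
    have [||u Uu [uK _]] := Uw (fun=> 1); first by [].
      by rewrite sumr_const ltr0n.
    exists u => //; rewrite divr1; apply: le_trans (sumK _ uK).
    by apply: ler_sum => i _; exact: max0_sqr_le.
  (* The positive part of the error points from the orthant below p to u. *)
  pose w i := Num.max 0 (u i - p i).
  have w0 i : 0 <= w i by rewrite le_max lexx.
  (* If the positive part vanishes, u is already below p and is kept. *)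
  have [W0|W0] := leP (\sum_i w i) 0.
    exists u => //; rewrite big1 ?divr_ge0// => i _.
    have /psumr_eq0P wE : \sum_i w i = 0 by apply/le_anti; rewrite W0 sumr_ge0.
    by rewrite -/(w i) wE// expr0n.
  have [u' Uu' [uK' uw']] := Uw w w0 W0.
  pose k : R := m.+1%:R; pose t := k / (k + 1).
  have k0 : 0 < k by rewrite ltr0n.
  have tE : 1 - t = (k + 1)^-1 by rewrite /t; field; lra.
  have t0 : 0 < t by rewrite divr_gt0//; lra.
  have t1 : 0 < 1 - t by rewrite tE invr_gt0; lra.
  exists (fun i => t * u i + (1 - t) * u' i).
    by apply: Uconv => //; rewrite t0 -subr_gt0.
  apply: (@le_trans _ _ (\sum_i (t ^+ 2 * w i ^+ 2 +
      2 * t * (1 - t) * (w i * (u' i - p i)) + (1 - t) ^+ 2 * (u' i - p i) ^+ 2))).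
    apply: ler_sum => i _.
    apply: (@le_trans _ _ ((t * w i + (1 - t) * (u' i - p i)) ^+ 2)).
      apply: max0_sqr_le.
      have : u i - p i <= w i by rewrite le_max lexx orbT.
      by move: (w i) (u i) (u' i) (p i) => *; nra.
    by rewrite le_eqVlt; apply/orP; left; apply/eqP; ring.
  rewrite !big_split/= -!mulr_sumr.
  apply: (@le_trans _ _ (t ^+ 2 * (C / k) + 0 + (1 - t) ^+ 2 * C)).
    apply: lerD; first apply: lerD.
    - by rewrite ler_wpM2l// sqr_ge0.
    - apply: mulr_ge0_le0 uw'; apply: mulr_ge0 (ltW t1).
      exact: mulr_ge0 (ltW t0).
    - by rewrite ler_wpM2l ?sqr_ge0// sumK.
  rewrite -[m.+2%:R]natr1 -/k tE /t le_eqVlt; apply/orP; left; apply/eqP.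
  by field; apply/andP; split; lra.
have [u Uu uC] := main (Num.bound (C / e ^+ 2)).
exists u => // i; rewrite -lerBlDl.
have : Num.max 0 (u i - p i) ^+ 2 <= e ^+ 2.
  apply: (@le_trans _ _ (C / (Num.bound (C / e ^+ 2)).+1%:R)).
    by apply: le_trans uC; rewrite (bigD1 i)//= lerDl sumr_ge0// => j _; rewrite sqr_ge0.
  rewrite ler_pdivrMr ?ltr0n// mulrC -ler_pdivrMr ?exprn_gt0//.
  apply: ltW; apply: lt_le_trans (archi_boundP _) _; last by rewrite ler_nat.
  by rewrite divr_ge0// sqr_ge0.
rewrite ler_pXn2r ?nnegrE ?le_max ?lexx ?(ltW e0)//.
by rewrite ge_max => /andP[].
Qed.

End approachability.

Section selection.
Context {d : measure_display} {T : measurableType d} {R : realType}.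
Variables (mu : probability T R) (D : set T).
Hypotheses (mD : measurable D) (muD : mu D = 1).

Lemma exists_lt_integral (H : T -> \bar R) (c : R) :
  (forall x, D x -> 0 <= H x) -> measurable_fun D H ->
  \int[mu]_(x in D) H x < c%:E -> exists2 x, D x & H x < c%:E.
Proof.
move=> H0 mH Hc; apply: contrapT => noD; move: Hc; apply/negP; rewrite -leNgt.
have cH x : D x -> c%:E <= H x.
  by move=> Dx; rewrite leNgt; apply/negP => Hx; apply: noD; exists x.
have [c0|c0] := leP 0%R c; last first.
  by apply: le_trans (integral_ge0 _ H0); rewrite lee_fin ltW.
have <- : \int[mu]_(x in D) c%:E = c%:E.
  by rewrite (integral_cst mu mD c%:E) -[RHS]mule1; congr (_ * _); exact: muD.
by apply: ge0_le_integral => //; exact: measurable_cst.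
Qed.

(** A single integral gives both conclusions: adding a small multiple [c] of the sum
    of all [k i] to the weighted sum costs less than the slack [e] in the mean, and
    at a point where the total is below the resulting bound each [k i] is at most
    this bound divided by [c].  With [c] proportional to the sum of the weights, the
    quotient is bounded independently of them. *)
Lemma integral_selection (I : finType) (k : I -> T -> \bar R) (J : I -> R) (e : R) :
  (0 < e)%R -> (forall i x, D x -> 0 <= k i x) ->
  (forall i, measurable_fun D (k i)) ->
  (forall i, \int[mu]_(x in D) k i x <= (J i)%:E) ->
  exists N : R, forall w : I -> R, (forall i, 0 <= w i)%R -> (0 < \sum_i w i)%R ->
    exists2 x, D x & exists r : I -> R,
      [/\ forall i, k i x = (r i)%:E, forall i, (r i <= N)%R &
          (\sum_i w i * (r i - (J i + e)) <= 0)%R].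
Proof.
move=> e0 k0 mk kJ.
have J0 i : (0 <= J i)%R.
  by rewrite -lee_fin; apply: le_trans (kJ i); apply: integral_ge0 => x; exact: k0.
pose B := (\sum_i J i)%R.
have B0 : (0 <= B)%R by exact: sumr_ge0.
exists ((B + e) * (B + 1) / e)%R => w w0 W0.
set W := (\sum_i w i)%R in W0.
(* Small enough for c * B < e * W, and proportional to W. *)
pose c := (e * W / (B + 1))%R.
have B1 : (0 < B + 1)%R by lra.
have c0 : (0 < c)%R by rewrite divr_gt0// mulr_gt0.
pose a := (\sum_i w i * J i)%R.
have aWB : (a <= W * B)%R.
  rewrite /B mulr_sumr; apply: ler_sum => i _; rewrite ler_wpM2r//.
  by rewrite /W (bigD1 i)//= lerDl sumr_ge0.
have cB : (c * B < e * W)%R.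
  by rewrite /c mulrAC ltr_pdivrMr// ltr_pM2l ?mulr_gt0//; lra.
pose H x := \sum_i ((w i + c)%:E * k i x).
have wc i : (0 <= w i + c)%R by rewrite addr_ge0// ltW.
have term0 i x : D x -> 0 <= (w i + c)%:E * k i x.
  by move=> Dx; rewrite mule_ge0 ?lee_fin// k0.
have mterm i : measurable_fun D (fun x => (w i + c)%:E * k i x).
  exact: measurable_funeM.
have [x Dx Hx] : exists2 x, D x & H x < (a + e * W)%:E.
  apply: exists_lt_integral.
  - by move=> x Dx; apply: sume_ge0 => i _; exact: term0.
  - exact: emeasurable_sum.
  rewrite (ge0_integral_sum mu mD mterm term0).
  apply: (@le_lt_trans _ _ (a + c * B)%:E); last by rewrite lte_fin; lra.
  rewrite /a /B mulr_sumr -big_split/= -sumEFin; apply: lee_sum => i _.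
  rewrite ge0_integralZl//; [|by move=> x; exact: k0|by rewrite lee_fin].
  by rewrite -mulrDl EFinM; apply: lee_wpmul2l; rewrite ?lee_fin.
have kN i : k i x <= ((B + e) * (B + 1) / e)%:E.
  have cb : c%:E * k i x <= (a + e * W)%:E.
    apply: le_trans (ltW Hx); rewrite /H (bigD1 i)//=.
    apply: (@le_trans _ _ ((w i + c)%:E * k i x)).
      by apply: lee_wpmul2r; rewrite ?k0// lee_fin lerDr.
    by rewrite leeDl//; apply: sume_ge0 => j _; exact: term0.
  have := k0 i x Dx; move: cb; case: (k i x) => [q| |]//=; last first.
    by rewrite gt0_muley ?lte_fin.
  rewrite -EFinM !lee_fin => cq q0; rewrite ler_pdivlMr//.
  move: cq; rewrite /c mulrAC ler_pdivrMr// => cq.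
  rewrite -(ler_pM2r W0); move: aWB cq; nra.
exists x => //; exists (fun i => fine (k i x)).
have kfin i : k i x = (fine (k i x))%:E.
  rewrite fineK// ge0_fin_numE ?k0//.
  by apply: le_lt_trans (kN i) _; rewrite ltry.
split => //.
  by move=> i; rewrite -lee_fin -kfin.
have : (\sum_i (w i + c) * fine (k i x) < a + e * W)%R.
  rewrite -lte_fin; apply: le_lt_trans Hx; rewrite -sumEFin /H.
  by apply: lee_sum => i _; rewrite EFinM -kfin.
have : (\sum_i w i * fine (k i x) <= \sum_i (w i + c) * fine (k i x))%R.
  apply: ler_sum => i _; rewrite ler_wpM2r ?lerDl ?(ltW c0)// -lee_fin -kfin.
  exact: k0.
have -> : (\sum_i w i * (fine (k i x) - (J i + e)) =
           \sum_i w i * fine (k i x) - (a + e * W))%R.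
  rewrite /a /W mulr_sumr -big_split/= -sumrB; apply: eq_bigr => i _; ring.
lra.
Qed.

End selection.

(** * Integration over the rotation group *)

Section integral_shift.
Context {d : measure_display} {T : measurableType d} {R : realType}.
Variables (mu : probability T R) (D : set T).
Hypotheses (mD : measurable D) (muD : mu D = 1).

(** The integral of [f] itself may be [+oo]; the negative part is bounded, which
    makes the additivity legitimate. *)
Lemma integral_add_cst (f : T -> \bar R) (C : R) : (0 <= C)%R ->
  measurable_fun D f -> (forall x, D x -> (- C)%:E <= f x) ->
  \int[mu]_(x in D) (f x + C%:E) = \int[mu]_(x in D) f x + C%:E.
Proof.
move=> C0 mf fC.
have intC : \int[mu]_(x in D) C%:E = C%:E.
  by rewrite (integral_cst mu mD C%:E) -[RHS]mule1; congr (_ * _); exact: muD.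
have fC0 x : D x -> 0 <= f x + C%:E.
  move=> /fC; case: (f x) => [r| |]//; last by rewrite addye ?leey.
  by rewrite -EFinD !lee_fin; lra.
have mfC : measurable_fun D (fun x => f x + C%:E).
  by apply: emeasurable_funD => //; exact: measurable_cst.
have mneg : measurable_fun D f^\- by exact: measurable_funeneg.
have mpos : measurable_fun D f^\+ by exact: measurable_funepos.
have neg_le : \int[mu]_(x in D) f^\- x <= C%:E.
  rewrite -intC; apply: ge0_le_integral => //.
  move=> x Dx; rewrite funenegE ge_max leeNl fC//=.
have neg_ge : 0 <= \int[mu]_(x in D) f^\- x by apply: integral_ge0 => x _; exact: funeneg_ge0.
have : \int[mu]_(x in D) (f x + C%:E) + \int[mu]_(x in D) f^\- x =
       \int[mu]_(x in D) f^\+ x + C%:E.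
  rewrite -{2}intC -!ge0_integralD//.
  apply: eq_integral => x /set_mem /fC; rewrite funeposE funenegE.
  case: (f x) => [r| |]//= _; last by rewrite maxye maxNye adde0.
  rewrite -!EFin_max -!EFinD; congr EFin.
  by case: (leP r 0%R) => r0; case: (leP (- r)%R 0%R) => r0'; lra.
rewrite [in X in _ -> X](integralE mu D f).
move: neg_le neg_ge; case: (\int[mu]_(x in D) f^\- x) => [q| |]//= _ _.
move=> /(congr1 (fun u => u - q%:E)); rewrite addeK// => ->.
by rewrite addeAC.
Qed.

End integral_shift.

Section measurability.
Context {R : realType} {n : nat}.

Lemma open_measurable_borel_mx (A : set (borel_mx R n)) :
  open (A : set 'M[R]_n) -> measurable A.
Proof. by move=> oA; apply: sub_sigma_algebra. Qed.

Lemma closed_measurable_borel_mx (A : set (borel_mx R n)) :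
  closed (A : set 'M[R]_n) -> measurable A.
Proof.
move=> cA; rewrite -(setCK A); apply: measurableC.
by apply: open_measurable_borel_mx; exact: closed_openC.
Qed.

Lemma lsc_measurable_borel_mx (f : borel_mx R n -> \bar R) :
  (forall a, open [set g : 'M[R]_n | a%:E < f g]) -> measurable_fun setT f.
Proof.
move=> of_; apply: (measurability _ (ErealGenOInfty.measurableE R)).
move=> /= _ [_ [a ->]] <-; apply: measurableI => //.
by apply: open_measurable_borel_mx; rewrite preimage_itvoy.
Qed.

Lemma continuous_entry (i j : 'I_n) : continuous (fun g : 'M[R]_n => g i j).
Proof. exact: coord_continuous. Qed.

Lemma continuous_trmx_mul (z : 'cV[R]_n) :
  continuous (fun g : 'M[R]_n => (g^T *m z)%R).
Proof.
have centry i j : continuous (fun g : 'M[R]_n => (g^T *m z)%R i j).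
  rewrite (_ : (fun g => _) = fun g : 'M[R]_n => (\sum_k g k i * z k j)%R); last first.
    by apply/funext => g; rewrite mxE; apply: eq_bigr => k _; rewrite mxE.
  apply: (@continuous_big _ _ +%R 0%R) => [|k _]; first exact: add_continuous.
  move=> g; have cg := @continuous_entry k i g.
  by apply: (@cvgM _ _ (nbhs g) _ (fun g : 'M[R]_n => g k i) (fun=> z k j)) => //;
    exact: cvg_cst.
move=> g A [P PA sPA].
have nP : \forall h \near g, forall ij, P ij.1 ij.2 ((h^T *m z)%R ij.1 ij.2).
  apply: (@filter_forall _ _ (fun ij (h : 'M[R]_n) =>
    P ij.1 ij.2 ((h^T *m z)%R ij.1 ij.2)) (nbhs g)).
  by move=> -[i j]; apply: (centry i j g); exact: PA.
suff : \forall h \near g, A (h^T *m z)%R by [].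
by apply: filterS nP => h Ph; apply: sPA => i j; exact: (Ph (i, j)).
Qed.

Lemma closed_special_orthogonal : closed (special_orthogonal_group R n).
Proof.
have -> : special_orthogonal_group R n =
    (\bigcap_(ij in [set: 'I_n * 'I_n])
      (fun g : 'M[R]_n => (g *m g^T)%R ij.1 ij.2) @^-1` [set c | c = 1%:M%R ij.1 ij.2])
    `&` (fun g : 'M[R]_n => (\det g)%R) @^-1` [set c | c = 1%R].
  apply/seteqP; split=> g [og dg]; split => //.
    by move=> ij _ /=; rewrite og.
  by apply/matrixP => i j; exact: (og (i, j)).
apply: closedI; last first.
  apply: closed_comp => [g _|]; last exact: closed_eq.
  move: g; apply: (@continuous_big _ _ +%R 0%R) => [|s _]; first exact: add_continuous.
  have cprod : continuous (fun g : 'M[R]_n => (\prod_i g i (s i))%R).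
    apply: (@continuous_big R 'I_n (fun a b : R => a * b)%R 1%R) => [|i _].
      exact: mul_continuous.
    exact: continuous_entry.
  move=> g; have cg := cprod g.
  by apply: (@cvgM _ _ (nbhs g) _ (fun=> ((-1) ^+ s : R)%R)
    (fun g : 'M[R]_n => (\prod_i g i (s i))%R)) => //; exact: cvg_cst.
apply: closed_bigI => -[i j] _; apply: closed_comp => [g _|]; last exact: closed_eq.
move: g; rewrite (_ : (fun g => _) = fun g : 'M[R]_n => (\sum_k g i k * g j k)%R); last first.
  by apply/funext => g; rewrite mxE; apply: eq_bigr => k _; rewrite mxE.
apply: (@continuous_big _ _ +%R 0%R) => [|k _]; first exact: add_continuous.
move=> g; have cg := @continuous_entry i k g; have cg' := @continuous_entry j k g.
exact: (@cvgM _ _ (nbhs g) _ (fun g : 'M[R]_n => g i k) (fun g : 'M[R]_n => g j k)).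
Qed.

Lemma measurable_special_orthogonal :
  measurable (special_orthogonal_group R n : set (borel_mx R n)).
Proof. exact: closed_measurable_borel_mx closed_special_orthogonal. Qed.

Lemma measurable_orbit (f : 'cV[R]_n -> \bar R) (z : 'cV[R]_n) :
  lower_semicontinuous f ->
  measurable_fun (special_orthogonal_group R n : set (borel_mx R n))
    (fun g : borel_mx R n => f (invmx (g : 'M[R]_n) *m z)%R).
Proof.
move=> /lower_semicontinuousP of_.
apply: (eq_measurable_fun (fun g : borel_mx R n => f ((g : 'M[R]_n)^T *m z)%R)).
  by move=> g /set_mem[og _]; rewrite orthogonal_invmx.
apply: measurable_funS (lsc_measurable_borel_mx _) => // a.
by apply: (open_comp _ (of_ a)) => g _; exact: continuous_trmx_mul.
Qed.

End measurability.

(** * Epi-convergence of suprema over countably many slopes *)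

Section ereal_limits.
Context {R : realType}.
Implicit Types (u : (\bar R)^nat) (a b : \bar R).

Lemma ereal_le_real a b : (forall r : R, r%:E < a -> r%:E <= b) -> a <= b.
Proof.
move=> ab; rewrite leNgt; apply/negP; case: b ab => [b| |] ab ba.
- have [r br ra] := ereal_real_between ba.
  by have := ab _ ra; rewrite lee_fin leNgt br.
- by case: a ba {ab}.
- have [r ra] : exists r : R, r%:E < a.
    case: a ba {ab} => [a| |]// _; last by exists 0%R; rewrite ltry.
    by exists (a - 1)%R; rewrite lte_fin ltrBlDr ltrDl.
  by have := ab _ ra.
Qed.

Lemma limn_einf_ge u a : (\forall j \near \oo, a <= u j) -> a <= limn_einf u.
Proof.
move=> [N _ Nu]; rewrite limn_einf_lim; apply: lime_ge; first exact: is_cvg_einfs.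
exists N => // k /= Nk; apply/ereal_infP => _ [j /= kj <-].
by apply: Nu => /=; exact: leq_trans kj.
Qed.

Lemma cvg_le_limn_einf u a : (forall j, u j <= a) -> a <= limn_einf u ->
  u @ \oo --> a.
Proof.
move=> ua au; have einf_le j : einfs u j <= u j.
  by apply: ereal_inf_lbound; exists j => /=.
have limE : limn (einfs u) = a.
  apply/eqP; rewrite eq_le -{2}limn_einf_lim au andbT.
  apply: lime_le; first exact: is_cvg_einfs.
  by apply: nearW => j; exact: le_trans (einf_le j) (ua j).
apply: (@squeeze_cvge _ _ _ _ (einfs u) _ (fun=> a)); last 2 first.
- by rewrite -[X in _ --> X]limE; exact: is_cvg_einfs.
- exact: cvg_cst.
by apply: nearW => j; rewrite einf_le ua.
Qed.

End ereal_limits.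

Section countable_subfamily.
Context {R : realType} {n : nat}.
Implicit Types (w : 'cV[R]_n -> R) (Y : set 'cV[R]_n).

Lemma rat_matrix_dense (x : 'cV[R]_n) (e : R) : (0 < e)%R ->
  exists c : 'cV[rat]_n, (`|x - map_mx ratr c| <= e)%R.
Proof.
move=> e0; have /choice[c cx] : forall i : 'I_n, exists q : rat, (`|x i 0 - ratr q| <= e)%R.
  move=> i; have [q] : exists q : rat, ratr q \in `](x i 0 - e)%R, (x i 0 + e)%R[.
    by apply: rat_in_itvoo; lra.
  rewrite in_itv/= => /andP[q1 q2]; exists q; rewrite ler_norml; lra.
exists (\col_i c i)%R; apply: norm_le_coord => [|i]; first exact: ltW.
by rewrite !mxE.
Qed.

(** A separability argument: for each rational ball and each rational level, pick one
    slope of [Y] whose affine function exceeds that level on that ball, if there is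
    one.  Balls are needed rather than rational points, because the domain of
    the supremum may contain no rational point. *)
Lemma affine_sup_countable w Y (y0 : 'cV[R]_n) : Y y0 ->
  exists2 d : nat -> 'cV[R]_n, (forall k, Y (d k)) &
    forall x (a : R), a%:E < affine_sup (EFin \o w) Y x ->
      exists k, (a < dotp x (d k) - w (d k))%R.
Proof.
move=> Yy0; pose J := ('cV[rat]_n * rat * rat)%type.
pose above (i : J) y := forall x, (`|x - map_mx ratr i.1.1| < ratr i.1.2)%R ->
  (ratr i.2 < dotp x y - w y)%R.
have /choice[D HD] : forall i : J, exists y, Y y /\
    ((exists2 y', Y y' & above i y') -> above i y).
  move=> i; have [[y Yy ay]|no] := pselect (exists2 y', Y y' & above i y').
    by exists y.
  by exists y0; split=> // /no.
exists (fun k => if unpickle k is Some i then D i else y0).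
  by move=> k; case: unpickle => [i|//]; exact: (HD i).1.
move=> x a /ereal_sup_gtP[_ [y Yy <-]] /=; rewrite -EFinB lte_fin => axy.
have [b] : exists b : rat, ratr b \in `]a, (dotp x y - w y)%R[.
  exact: rat_in_itvoo.
rewrite in_itv/= => /andP[ab bxy].
have /nbhs_ballP[e /= e0 eb] : \forall x' \near x, (ratr b + w y < dotp x' y)%R.
  by apply: dotp_near_gt; rewrite -ltrBrDr.
(* The radius exceeds the distance e / 4 from x to c and keeps the ball inside ball x e. *)
have [rho] : exists r : rat, ratr r \in `](e / 4)%R, (e / 2)%R[.
  by apply: rat_in_itvoo; lra.
rewrite in_itv/= => /andP[rho1 rho2].
have [c xc] := @rat_matrix_dense x (e / 4) (divr_gt0 e0 (ltr0n _ 4)).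
pose i : J := (c, rho, b).
have /(HD i).2 ai : exists2 y', Y y' & above i y'.
  exists y => // x' x'c; rewrite ltrBrDr; apply: eb.
  rewrite -ball_normE /ball_/= -(subrK (map_mx ratr c) x) -addrA.
  rewrite (le_lt_trans (ler_normD _ _))// (distrC _ x').
  by move: xc x'c; rewrite /i/=; lra.
exists (pickle i); rewrite pickleK; apply: lt_trans ab _; apply: ai.
by rewrite /i/=; apply: le_lt_trans xc _.
Qed.

End countable_subfamily.

Section finite_spanning.
Context {R : realType} {n : nat}.
Implicit Types (Y : set 'cV[R]_n) (z : 'cV[R]_n).

Lemma pos_subset Y Y' z : Y `<=` Y' -> pos Y z -> pos Y' z.
Proof.
move=> YY' [k [a [u [au ->]]]]; exists k, a, u; split=> // i.
by have [ai Yu] := au i; split=> //; exact: YY'.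
Qed.

Lemma pos_finite Y z : pos Y z ->
  exists2 L : seq 'cV[R]_n, (forall y, y \in L -> Y y) & pos [set` L] z.
Proof.
move=> [k [a [u [au ->]]]]; exists [seq u i | i : 'I_k].
  by move=> y /mapP[i _ ->]; exact: (au i).2.
exists k, a, u; split=> // i; split; first exact: (au i).1.
by apply/mapP; exists i => //; rewrite mem_enum.
Qed.

Lemma pos_finite_family (I : finType) Y (z : I -> 'cV[R]_n) : (forall i, pos Y (z i)) ->
  exists2 L : seq 'cV[R]_n, (forall y, y \in L -> Y y) & forall i, pos [set` L] (z i).
Proof.
move=> posz; have /choice[F FY] : forall i, exists L : seq 'cV[R]_n,
    (forall y, y \in L -> Y y) /\ pos [set` L] (z i).
  by move=> i; have [L LY Lz] := pos_finite (posz i); exists L.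
exists (flatten [seq F i | i : I]).
  by move=> y /flattenP[_ /mapP[i _ ->]]; exact: (FY i).1.
move=> i; apply: pos_subset (FY i).2 => y /= yF.
by apply/flattenP; exists (F i) => //; apply/mapP; exists i => //; rewrite mem_enum.
Qed.

End finite_spanning.

Section epi_limit.
Context {R : realType} {n : nat} (n_gt0 : (0 < n)%N).
Implicit Types (w : 'cV[R]_n -> R) (Y : set 'cV[R]_n).

(** The suprema [f k] over finite sets of slopes, lowered by [1/(k+1)], lie below the
    limit function, so that constant sequences are recovery sequences; every fixed
    slope of the countable family is eventually present, which gives the lower
    bound for the inferior limit. *)
Lemma affine_sup_limit (Phi : ('cV[R]_n -> \bar R) -> \bar R) (V : \bar R) w Y :
  usc_functional Phi -> decreasing_functional Phi ->
  (forall i (b : bool), pos Y ((-1) ^+ b *: delta_mx i 0)%R) ->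
  (exists x, affine_sup (EFin \o w) Y x != +oo) ->
  (forall (L : seq 'cV[R]_n) (e : R), (forall y, y \in L -> Y y) -> (0 < e)%R ->
    exists h, [/\ Conv_c R n h, V <= Phi h &
      forall y x, y \in L -> (dotp x y - (w y + e))%:E <= h x]) ->
  V <= Phi (affine_sup (EFin \o w) Y).
Proof.
move=> Phi_usc Phi_decr posY [x1 qx1] VL.
set q := affine_sup (EFin \o w) Y.
have [base baseY posbase] : exists2 L : seq 'cV[R]_n, (forall y, y \in L -> Y y) &
    forall ib : 'I_n * bool, pos [set` L] ((-1) ^+ ib.2 *: delta_mx ib.1 0)%R.
  by apply: pos_finite_family => -[i b]; exact: posY.
have [y0 Yy0] : Y !=set0.
  apply: (pos_nonempty (posY (Ordinal n_gt0) false)).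
  rewrite expr0 scale1r; apply/eqP => /matrixP/(_ (Ordinal n_gt0) 0%R).
  by rewrite !mxE !eqxx => /eqP; rewrite oner_eq0.
have [d dY dsup] := affine_sup_countable w Yy0.
(* The finite spanning family base keeps every supremum f k coercive. *)
pose L k := base ++ mkseq d k.
have LY k y : y \in L k -> Y y.
  by rewrite mem_cat => /orP[/baseY//|/mapP[j _ ->]].
pose f k := affine_sup (fun y => (w y + k.+1%:R^-1)%:E) [set` L k].
have fq k x : f k x <= q x.
  apply/affine_sup_leP => y /LY Yy; apply: le_trans (affine_sup_ge _ _ Yy) => /=.
  by rewrite -!EFinB lee_fin opprD addrA gerBl.
have cf k : Conv_c R n (f k).
  apply: (Conv_c_affine_sup n_gt0 (Yo := [set` base])) => //.
  - by move=> y /=; rewrite mem_cat => ->.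
  - by move=> y _; rewrite ltry.
  - by move=> i b; exact: (posbase (i, b)).
  - exists x1; rewrite -ltey; apply: le_lt_trans (fq k x1) _.
    by rewrite ltey.
have cq : Conv_c R n q.
  apply: (Conv_c_affine_sup n_gt0 (Yo := Y)) => //; last by exists x1.
  by move=> y _; rewrite ltry.
have Vf k : V <= Phi (f k).
  have [|h [ch Vh hL]] := VL (L k) (k.+1%:R^-1)%R (@LY k); first by [].
  apply: le_trans Vh _; apply: Phi_decr => // x.
  by apply/affine_sup_leP => y /= yL; rewrite -EFinB; exact: hL.
have liminf x (x_ : nat -> 'cV[R]_n) : x_ @ \oo --> x ->
    q x <= limn_einf (fun j => f j (x_ j)).
  move=> xx; apply: ereal_le_real => a /dsup[k adk].
  apply: limn_einf_ge.
  have cv : (dotp (x_ j) (d k) - j.+1%:R^-1)%R @[j --> \oo] --> (dotp x (d k) - 0)%R.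
    apply: cvgB; last exact: cvg_harmonic.
    exact: (cvg_comp _ _ xx (@continuous_dotp R n (d k) x)).
  have near_gt : \forall j \near \oo, (a + w (d k) < dotp (x_ j) (d k) - j.+1%:R^-1)%R.
    by apply: (cvgr_gt _ cv); rewrite subr0 -ltrBrDr.
  have near_k : \forall j \near \oo, (k < j)%N by exists k.+1.
  apply: filterS2 near_gt near_k => j ajk kj.
  have dkL : [set` L j] (d k).
    by rewrite /= mem_cat; apply/orP; right; apply/mapP; exists k; rewrite ?mem_iota.
  apply: le_trans (affine_sup_ge _ _ dkL).
  rewrite -EFinB lee_fin; move: ajk => /=.
  by move: (j.+1%:R^-1)%R (dotp _ _) (w _) => r s t; lra.
have fepi : epi_cvg f q.
  move=> x; split; first exact: liminf.
  exists (fun=> x); first exact: cvg_cst.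
  by apply: cvg_le_limn_einf => //; apply: liminf; exact: cvg_cst.
apply: le_trans (Phi_usc _ _ cf cq fepi).
apply: le_trans (limn_einf_sup _); apply: limn_einf_ge.
exact: nearW.
Qed.

End epi_limit.

(** * Outer linearizations of rotated functions *)

Section well_defined.
Context {R : realType} {n : nat} (n_gt0 : (0 < n)%N).
Implicit Types (p psi : 'cV[R]_n -> \bar R) (Y : set 'cV[R]_n).
Implicit Types (x y : 'cV[R]_n) (g : 'M[R]_n).

Lemma affine_sup_legendre_le p Y x0 x : p x0 != +oo ->
  affine_sup (legendre p) Y x <= p x.
Proof.
move=> px0; apply/affine_sup_leP => y _.
have := legendre_proper_gt y px0; have := legendre_ge p y x; rewrite dotpC.
case: (legendre p y) => [l| |]//=; rewrite ?leNye//.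
by case: (p x) => [q| |]//=; rewrite ?leey -?EFinB -?EFinD ?lee_fin//; lra.
Qed.

Lemma outer_lin_rotateE p g Y x0 : p x0 != +oo -> orthogonal_group R n g ->
  outer_lin (rotate g p) Y = affine_sup (fun y => legendre p (invmx g *m y)%R) Y.
Proof.
move=> px0 og.
rewrite (@outer_linE _ _ (rotate g p) _ (g *m x0)%R); last first.
  have gU : g \in unitmx by have [] := mulmx1_unit og.
  by rewrite /rotate mulKmx.
by congr affine_sup; apply/funext => y; exact: legendre_rotate.
Qed.

Lemma outer_lin_rotate_proper p g Y x0 : p x0 != +oo -> orthogonal_group R n g ->
  exists x, outer_lin (rotate g p) Y x != +oo.
Proof.
move=> px0 og; have gU : g \in unitmx by have [] := mulmx1_unit og.
have gpx0 : rotate g p (g *m x0)%R != +oo by rewrite /rotate mulKmx.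
exists (g *m x0)%R; rewrite (outer_linE _ gpx0) -ltey.
by apply: le_lt_trans (affine_sup_legendre_le _ _ gpx0) _; rewrite ltey.
Qed.

Lemma Conv_c_outer_lin p g Y Yo x0 : p x0 != +oo -> orthogonal_group R n g ->
  Yo `<=` Y -> pos Yo = setT ->
  (forall y, Yo y -> legendre p (invmx g *m y)%R < +oo) ->
  Conv_c R n (outer_lin (rotate g p) Y).
Proof.
move=> px0 og YoY posYo pYo; have := outer_lin_rotate_proper Y px0 og.
rewrite (outer_lin_rotateE _ px0 og) => proper_q.
by apply: (Conv_c_affine_sup n_gt0 YoY) => // i b; rewrite posYo.
Qed.

End well_defined.

Section admissible.
Context {R : realType} {n : nat} (n_gt0 : (0 < n)%N).
Implicit Types (p psi : 'cV[R]_n -> \bar R) (Y : set 'cV[R]_n).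
Implicit Types (x y z : 'cV[R]_n) (g : 'M[R]_n).

Lemma Conv_c_real psi : Conv_c R n psi -> exists x0 (q0 : R), psi x0 = q0%:E.
Proof.
move=> [psiNy _ [x0 px0] _ _]; exists x0; have := psiNy x0.
by move: px0; case: (psi x0) => [q| |]// _ _; exists q.
Qed.

Lemma admissible_slopes_bounded psi Y : admissible_slopes psi Y ->
  exists Yo, [/\ Yo `<=` Y, pos Yo = setT & forall y, Yo y ->
    exists M : R, forall z, (enorm z <= enorm y)%R -> legendre psi z <= M%:E].
Proof.
move=> [Yo [YoY posYo intYo]]; exists Yo; split=> // y /intYo.
move=> /(interior_inner_radius n_gt0)[s ys psifin].
by apply: legendre_bounded psifin; rewrite enorm_ge0.
Qed.

Lemma enorm_invmx g y : orthogonal_group R n g -> enorm (invmx g *m y)%R = enorm y.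
Proof.
by move=> og; rewrite orthogonal_invmx// enorm_orthogonal//; exact: orthogonal_trmx.
Qed.

Lemma invmxM g h : orthogonal_group R n g -> orthogonal_group R n h ->
  invmx (g *m h)%R = (invmx h *m invmx g)%R.
Proof.
by move=> og oh; rewrite !orthogonal_invmx ?trmx_mul//; exact: orthogonalM.
Qed.

Lemma orthogonalN g : orthogonal_group R n g -> orthogonal_group R n (- g)%R.
Proof.
by rewrite /orthogonal_group/= => og; rewrite linearN mulmxN mulNmx opprK.
Qed.

Lemma invmxN g : orthogonal_group R n g -> invmx (- g)%R = (- invmx g)%R.
Proof.
by move=> og; rewrite !orthogonal_invmx ?linearN//; exact: orthogonalN.
Qed.

End admissible.

(** * Epi-means and concave functionals *)

Section epi_mean.
Context {R : realType} {n : nat}.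
Implicit Types (f h : 'cV[R]_n -> \bar R) (x y : 'cV[R]_n) (t u : R).

(** The constants of affine minorants of equal slope are averaged by epi-means, as
    the Legendre transform turns epi-means into means. *)
Lemma epi_mean_minorant t f h y (a b : R) : (0 < t < 1)%R ->
  (forall x, (dotp x y - a)%:E <= f x) -> (forall x, (dotp x y - b)%:E <= h x) ->
  forall x, (dotp x y - (t * a + (1 - t) * b))%:E <=
    epi_sum (epi_mul t f) (epi_mul (1 - t)%R h) x.
Proof.
move=> /andP[t0 t1] fa hb x; apply/ereal_infP => _ [z _ <-]; rewrite /epi_mul.
have t1' : (0 < 1 - t)%R by rewrite subr_gt0.
apply: (@le_trans _ _ (t%:E * (dotp (t^-1 *: (x - z)) y - a)%:E +
                       (1 - t)%:E * (dotp ((1 - t)^-1 *: z) y - b)%:E)).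
  rewrite -!EFinM -EFinD lee_fin !mulrBr !dotpZl.
  rewrite !mulVKf ?lt0r_neq0// dotpDl dotpNl; lra.
by apply: leeD; (apply: lee_wpmul2l; [rewrite lee_fin ltW|]).
Qed.

(** The identity [t V + (1 - t) V = V] persists for infinite [V], since both summands
    are then the same infinity. *)
Lemma concave_lower_bound (Phi : ('cV[R]_n -> \bar R) -> \bar R) (V : \bar R) t f h :
  concave_functional Phi -> Conv_c R n f -> Conv_c R n h -> (0 < t < 1)%R ->
  V <= Phi f -> V <= Phi h ->
  V <= Phi (epi_sum (epi_mul t f) (epi_mul (1 - t)%R h)).
Proof.
move=> Phi_conc cf ch t01 Vf Vh; apply: le_trans (Phi_conc _ _ _ cf ch t01).
have /andP[t0 t1] := t01; have t1' : (0 < 1 - t)%R by rewrite subr_gt0.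
have <- : t%:E * V + (1 - t)%:E * V = V.
  case: V {Vf Vh} => [v| |].
  - by rewrite -!EFinM -EFinD; congr EFin; ring.
  - by rewrite !gt0_muley ?lte_fin.
  - by rewrite !gt0_muleNy ?lte_fin.
by apply: leeD; (apply: lee_wpmul2l; [rewrite lee_fin ltW|]).
Qed.

Lemma Conv_c_epi_mean t f h : (0 < t < 1)%R -> Conv_c R n f -> Conv_c R n h ->
  Conv_c R n (epi_sum (epi_mul t f) (epi_mul (1 - t)%R h)).
Proof.
move=> /andP[t0 t1] cf ch; apply: Conv_c_epi_sum; apply: Conv_c_epi_mul => //.
by rewrite subr_gt0.
Qed.

End epi_mean.

(** * Epi-means of two functions and their Legendre transforms *)

Section epi_mean_legendre.
Context {R : realType} {n : nat}.
Implicit Types (f h psi : 'cV[R]_n -> \bar R) (x y z : 'cV[R]_n).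

Lemma epi_mulD (t : R) f h : (0 < t)%R ->
  (forall x, f x != -oo) -> (forall x, h x != -oo) ->
  epi_mul t (epi_sum f h) = epi_sum (epi_mul t f) (epi_mul t h).
Proof.
move=> t0 fNy hNy; apply/funext => x; rewrite /epi_mul /epi_sum -ereal_inf_pZl//.
have fh a b : t%:E * (f a + h b) = t%:E * f a + t%:E * h b.
  rewrite muleDr//; move: (fNy a) (hNy b).
  by case: (f a) => [?| |]//; case: (h b) => [?| |].
congr ereal_inf; apply/seteqP; split=> [_ [_ [y _ <-] <-]|_ [y _ <-]].
  exists (t *: y)%R => //; rewrite fh scalerBr !scalerA mulVf ?lt0r_neq0//.
  by rewrite scale1r.
exists (f (t^-1 *: x - t^-1 *: y)%R + h (t^-1 *: y)%R); first by exists (t^-1 *: y)%R.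
by rewrite fh scalerBr.
Qed.

(** If the transform of the epi-mean is finite at [z], so are both transforms: fixing
    a point in the domain of one function bounds the transform of the other. *)
Lemma legendre_epi_mean_split (f h : 'cV[R]_n -> \bar R) x1 x2 (q1 q2 : R) z (l : R) :
  f x1 = q1%:E -> h x2 = q2%:E ->
  (forall x, f x != -oo) -> (forall x, h x != -oo) ->
  legendre (epi_sum (epi_mul 2^-1 f) (epi_mul 2^-1 h)) z = l%:E ->
  exists a b : R, [/\ legendre f z = a%:E, legendre h z = b%:E &
    (2^-1 * a + 2^-1 * b <= l)%R].
Proof.
move=> fx1 hx2 fNy hNy legl.
have key u v (c d : R) : f u = c%:E -> h v = d%:E ->
    (dotp z u - c + (dotp z v - d) <= 2 * l)%R.
  move=> fu hv; set F := epi_sum _ _ in legl.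
  have Fuv : F (2^-1 *: u + 2^-1 *: v)%R <= (2^-1 * c + 2^-1 * d)%:E.
    apply: le_trans (epi_sum_leP _ _ _ (2^-1 *: v)%R) _.
    by rewrite addrK /epi_mul !scalerA mulVf ?invr_eq0// !scale1r fu hv.
  have := legendre_ge F z (2^-1 *: u + 2^-1 *: v)%R; rewrite legl.
  move: Fuv; case: (F _) => [r| |]//=; rewrite -?EFinB !lee_fin.
  by rewrite dotpDr !dotpZr; lra.
have [a fa] : exists a : R, legendre f z = a%:E.
  have : legendre f z <= (2 * l - (dotp z x2 - q2))%:E.
    apply/affine_sup_leP => u _; have := fNy u; case fu: (f u) => [c| |]// _;
      last by rewrite leNye.
    by rewrite -EFinB lee_fin; have := key _ _ _ _ fu hx2; lra.
  have := @legendre_proper_gt _ _ f x1 z; rewrite fx1 => /(_ isT).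
  by case: (legendre f z) => [a| |]// _ _; exists a.
have hb : legendre h z <= (2 * l - a)%:E.
  apply/affine_sup_leP => v _; have := hNy v; case hv: (h v) => [d| |]// _;
    last by rewrite leNye.
  have : legendre f z <= (2 * l - (dotp z v - d))%:E.
    apply/affine_sup_leP => u _; have := fNy u; case fu: (f u) => [c| |]// _;
      last by rewrite leNye.
    by rewrite -EFinB lee_fin; have := key _ _ _ _ fu hv; lra.
  by rewrite fa -EFinB !lee_fin; lra.
have := @legendre_proper_gt _ _ h x2 z; rewrite hx2 => /(_ isT).
move: hb; case: (legendre h z) => [b| |]//; rewrite lee_fin => hb _.
by exists a, b; split => //; lra.
Qed.

Lemma legendre_reflect psi z : legendre (reflect_fun psi) z = legendre psi (- z)%R.
Proof.
apply/eqP; rewrite eq_le; apply/andP; split; apply/affine_sup_leP => x _.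
  apply: le_trans (legendre_ge psi _ (- x)%R).
  by rewrite dotpNl dotpNr opprK.
apply: le_trans (legendre_ge (reflect_fun psi) _ (- x)%R).
by rewrite /reflect_fun opprK dotpNl dotpNr.
Qed.

Lemma legendre_epi_mean_le f h z (M : R) : 
  legendre f z <= M%:E -> legendre h z <= M%:E ->
  legendre (epi_sum (epi_mul 2^-1 f) (epi_mul 2^-1 h)) z <= M%:E.
Proof.
move=> /affine_sup_leP fM /affine_sup_leP hM.
have minorant k : (forall x, setT x -> (dotp z x)%:E - k x <= M%:E) ->
    forall x : 'cV[R]_n, (dotp x z - M)%:E <= k x.
  move=> kM x; have := kM x I; rewrite (dotpC z).
  by case: (k x) => [r| |]//=; rewrite ?leey -?EFinB ?lee_fin//; lra.
apply/affine_sup_leP => x _.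
have half01 : ((0 < (2^-1 : R)) && ((2^-1 : R) < 1))%R.
  by rewrite invr_gt0 ltr0n invf_lt1 ?ltr1n.
have := epi_mean_minorant half01 (minorant _ fM) (minorant _ hM) x.
have -> : (1 - 2^-1 = 2^-1 :> R)%R by lra.
have -> : (2^-1 * M + 2^-1 * M = M)%R by lra.
rewrite (dotpC z); case: (epi_sum _ _ x) => [r| |]//=; rewrite ?leNye//.
by rewrite -EFinB !lee_fin; lra.
Qed.

End epi_mean_legendre.

(** * Comparison with the symmetrized function *)

Section functional.
Context {R : realType} {n : nat} (n_gt0 : (0 < n)%N).
Variable Phi : ('cV[R]_n -> \bar R) -> \bar R.
Hypothesis Phi_usc : usc_functional Phi.
Hypothesis Phi_concave : concave_functional Phi.
Hypothesis Phi_decreasing : decreasing_functional Phi.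
Variables (psi : 'cV[R]_n -> \bar R) (YY : set (set 'cV[R]_n)).
Hypothesis psi_Conv_c : Conv_c R n psi.
Hypothesis YY_admissible : YY `<=` admissible_slopes psi.
Implicit Types (x y z : 'cV[R]_n) (g : 'M[R]_n) (Y : set 'cV[R]_n).

Lemma Conv_c_outer_lin_admissible Y g : YY Y -> orthogonal_group R n g ->
  Conv_c R n (outer_lin (rotate g psi) Y).
Proof.
move=> /YY_admissible/(admissible_slopes_bounded n_gt0)[Yo [YoY posYo psiM]] og.
have [x0 [q0 px0]] := Conv_c_real psi_Conv_c.
apply: (Conv_c_outer_lin n_gt0 (x0 := x0)) YoY posYo _ => //; first by rewrite px0.
move=> y /psiM[M]; move/(_ (invmx g *m y)%R); rewrite enorm_invmx// => /(_ (lexx _)).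
by move=> /le_lt_trans; apply; rewrite ltry.
Qed.

(** The hypothesis on [psi_rot] is what the two forms of symmetrization share: an
    average over rotations of values on a ball inherits their upper bound. *)
Lemma Conv_c_outer_lin_rot psi_rot x1 Y g : psi_rot x1 != +oo ->
  (forall z (M : R), (forall z', (enorm z' <= enorm z)%R -> legendre psi z' <= M%:E) ->
     legendre psi_rot z < +oo) ->
  YY Y -> orthogonal_group R n g ->
  Conv_c R n (outer_lin (rotate g psi_rot) Y).
Proof.
move=> prx1 rot_fin /YY_admissible/(admissible_slopes_bounded n_gt0).
move=> [Yo [YoY posYo psiM]] og.
apply: (Conv_c_outer_lin n_gt0 (x0 := x1)) YoY posYo _ => //.
move=> y /psiM[M psiMy]; apply: (rot_fin _ M) => z'.
by rewrite enorm_invmx//; exact: psiMy.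
Qed.

Lemma Phi_star_le g Y : rotations g -> YY Y ->
  Phi_star Phi psi YY <= Phi (outer_lin (rotate g psi) Y).
Proof. by move=> rg YYY; apply: ereal_inf_lbound; exists g, Y. Qed.

Lemma rotations_orthogonal g : rotations g -> orthogonal_group R n g.
Proof. by rewrite /rotations; case: ifP => // _ []. Qed.

Section symmetrization_dim1.
Hypothesis n1 : n = 1%N.
Let psi_rot := epi_mul 2^-1%R (epi_sum psi (reflect_fun psi)).

Let psi_rotE : psi_rot = epi_sum (epi_mul 2^-1%R psi) (epi_mul 2^-1%R (reflect_fun psi)).
Proof.
have [psiNy _ _ _ _] := psi_Conv_c.
by apply: epi_mulD => // x; exact: psiNy.
Qed.

Lemma epi_sym_dim1_proper : exists x1, psi_rot x1 != +oo.
Proof.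
have [x0 [q0 px0]] := Conv_c_real psi_Conv_c.
exists 0%R; rewrite -ltey psi_rotE.
apply: le_lt_trans (epi_sum_leP _ _ _ (2^-1 *: - x0)%R) _.
rewrite /epi_mul sub0r !scalerN opprK !scalerA mulVf ?invr_eq0// scale1r.
by rewrite /reflect_fun opprK px0 -!EFinM -EFinD ltry.
Qed.

Lemma epi_sym_dim1_finite z (M : R) :
  (forall z', (enorm z' <= enorm z)%R -> legendre psi z' <= M%:E) ->
  legendre psi_rot z < +oo.
Proof.
move=> psiM; apply: (@le_lt_trans _ _ M%:E); last by rewrite ltry.
rewrite psi_rotE; apply: legendre_epi_mean_le; first exact: psiM.
by rewrite legendre_reflect; apply: psiM; rewrite enormN.
Qed.

(** In dimension one the rotations are 1 and -1; taking the pair [g], [-g] avoids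
    distinguishing them. *)
Lemma Phi_star_le_sym_dim1 g Y : rotations g -> YY Y ->
  Phi_star Phi psi YY <= Phi (outer_lin (rotate g psi_rot) Y).
Proof.
move=> rg YYY; have og := rotations_orthogonal rg.
have rNg : rotations (- g)%R.
  by rewrite /rotations ifT ?n1//; exact: orthogonalN.
have [psiNy _ _ _ _] := psi_Conv_c.
have [x0 [q0 px0]] := Conv_c_real psi_Conv_c.
have [x1 px1] := epi_sym_dim1_proper.
have half01 : ((0 < (2^-1 : R)) && ((2^-1 : R) < 1))%R.
  by rewrite invr_gt0 ltr0n invf_lt1 ?ltr1n.
have halfE : (1 - 2^-1 = 2^-1 :> R)%R by lra.
pose h g := outer_lin (rotate g psi) Y.
have ch k : orthogonal_group R n k -> Conv_c R n (h k).
  exact: Conv_c_outer_lin_admissible.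
have cNg := ch _ (orthogonalN og); have cg := ch _ og.
apply: le_trans (concave_lower_bound Phi_concave cg cNg half01
  (Phi_star_le rg YYY) (Phi_star_le rNg YYY)) _.
apply: Phi_decreasing.
- exact: Conv_c_epi_mean.
- exact: (Conv_c_outer_lin_rot px1 epi_sym_dim1_finite).
move=> x; rewrite (outer_lin_rotateE _ px1 og); apply/affine_sup_leP => y Yy.
have := legendre_proper_gt (invmx g *m y)%R px1.
case legl: (legendre psi_rot _) => [l| |]// _; last by rewrite leNye.
rewrite psi_rotE in legl.
have rx0 : reflect_fun psi (- x0)%R = q0%:E by rewrite /reflect_fun opprK.
have rNy z : reflect_fun psi z != -oo by exact: psiNy.
have [a [b [la lb abl]]] := legendre_epi_mean_split px0 rx0 psiNy rNy legl.
rewrite legendre_reflect -mulNmx -invmxN// in lb.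
have minorant k c : orthogonal_group R n k -> legendre psi (invmx k *m y)%R = c%:E ->
    forall x, (dotp x y - c)%:E <= h k x.
  have px0y : psi x0 != +oo by rewrite px0.
  move=> ok kc x'; rewrite /h (outer_lin_rotateE _ px0y ok).
  by rewrite EFinB -kc; exact: affine_sup_ge.
apply: le_trans (epi_mean_minorant half01 (minorant _ _ og la)
  (minorant _ _ (orthogonalN og) lb) x).
by rewrite -EFinB lee_fin halfE; lra.
Qed.

End symmetrization_dim1.

Section symmetrization.
Variables (mu : probability (borel_mx R n) R) (psi_rot : 'cV[R]_n -> \bar R).
Let SO : set (borel_mx R n) := special_orthogonal_group R n.
Hypothesis mu_SO : mu SO = 1.
Hypothesis rotations_SO : rotations = special_orthogonal_group R n.
Hypothesis psi_rot_Conv_c : Conv_c R n psi_rot.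
Hypothesis legendre_rot : forall x, legendre psi_rot x =
  \int[mu]_(g in SO) legendre psi (invmx (g : 'M[R]_n) *m x)%R.

Let orbit (z : 'cV[R]_n) (g : borel_mx R n) : \bar R :=
  legendre psi (invmx (g : 'M[R]_n) *m z)%R.

Let mSO : measurable SO. Proof. exact: measurable_special_orthogonal. Qed.

Let morbit z : measurable_fun SO (orbit z).
Proof. exact: (@measurable_orbit R n (legendre psi) z (@lsc_affine_sup R n psi setT)). Qed.

(** Adding a constant makes the transform nonnegative on the orbit of [z], where it
    is bounded below because its argument has constant Euclidean norm. *)
Lemma integral_orbit_shift z : exists2 C : R, (forall g, SO g -> 0 <= orbit z g + C%:E) &
  \int[mu]_(g in SO) (orbit z g + C%:E) = legendre psi_rot z + C%:E.
Proof.
have [x0 [q0 px0]] := Conv_c_real psi_Conv_c.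
have [C psiC] := legendre_lower_bound px0 (enorm z).
have orbitC g : SO g -> (- `|C|)%:E <= orbit z g.
  move=> [og _]; apply: (@le_trans _ _ (- C)%:E).
    by rewrite lee_fin lerN2 ler_norm.
  by apply: psiC; rewrite enorm_invmx.
exists `|C|%R.
  move=> g /orbitC; case: (orbit z g) => [r| |]//; last by rewrite addye ?leey.
  by rewrite -EFinD !lee_fin; lra.
by rewrite legendre_rot (integral_add_cst mSO mu_SO)//.
Qed.

Lemma epi_sym_finite z (M : R) :
  (forall z', (enorm z' <= enorm z)%R -> legendre psi z' <= M%:E) ->
  legendre psi_rot z < +oo.
Proof.
move=> psiM; have [C orbitC intC] := integral_orbit_shift z.
have : \int[mu]_(g in SO) (orbit z g + C%:E) <= (M + C)%:E.
  have <- : \int[mu]_(g in SO) (M + C)%:E = (M + C)%:E.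
    by rewrite (integral_cst mu mSO (M + C)%:E) -[RHS]mule1; congr (_ * _); exact: mu_SO.
  have leM g : SO g -> orbit z g + C%:E <= (M + C)%:E.
    by move=> [og _]; rewrite EFinD leeD2r// psiM// enorm_invmx.
  apply: ge0_le_integral => //.
    by apply: emeasurable_funD => //; exact: measurable_cst.
by rewrite intC; case: (legendre psi_rot z) => [r| |]//= _; rewrite ltry.
Qed.

(** The vectors [u] for which some [h] with [Phi h >= Phi_star] lies above all
    [<.,y> - u y] form a convex set, to which the approachability argument applies:
    the points it requires are provided by single rotations.  They
    are rotated by [g] to match the rotated copy of [psi_rot]. *)
Lemma finite_epi_mean_minorant g Y (L : seq 'cV[R]_n) (w : 'cV[R]_n -> R) (e : R) :
  special_orthogonal_group R n g -> YY Y -> (0 < e)%R -> L != [::] ->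
  (forall y, y \in L -> Y y /\ legendre psi_rot (invmx g *m y)%R = (w y)%:E) ->
  exists h, [/\ Conv_c R n h, Phi_star Phi psi YY <= Phi h &
    forall y x, y \in L -> (dotp x y - (w y + e))%:E <= h x].
Proof.
move=> SOg YYY e0 L0 Lw; have og := SOg.1.
have [x0 [q0 px0]] := Conv_c_real psi_Conv_c.
have px0y : psi x0 != +oo by rewrite px0.
pose I := 'I_(size L); pose y_ (i : I) := tnth (in_tuple L) i.
have yL i : y_ i \in L by exact: mem_tnth.
have /choice[C HC] : forall i : I, exists C : R,
    (forall h, SO h -> 0 <= orbit (invmx g *m y_ i)%R h + C%:E) /\
    \int[mu]_(h in SO) (orbit (invmx g *m y_ i)%R h + C%:E) = (w (y_ i) + C)%:E.
  move=> i; have [C C0 intC] := integral_orbit_shift (invmx g *m y_ i)%R.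
  by exists C; rewrite intC (Lw _ (yL i)).2.
pose k i (h : borel_mx R n) := orbit (invmx g *m y_ i)%R h + (C i)%:E.
pose J i := (w (y_ i) + C i)%R.
have e20 : (0 < e / 2)%R by lra.
have [|||N HN] := integral_selection (mu := mu) mSO mu_SO (k := k) (J := J) e20.
- by move=> i h; exact: (HC i).1.
- by move=> i; apply: emeasurable_funD => //; exact: measurable_cst.
- by move=> i; rewrite (HC i).2.
pose U : set (I -> R) := [set u | exists h, [/\ Conv_c R n h, Phi_star Phi psi YY <= Phi h &
    forall i x, (dotp x (y_ i) - u i)%:E <= h x]].
have [|||] := @approachability R I U (fun i => w (y_ i) + e / 2)%R
    (`|N| + \sum_i `|J i| + e)%R _ _ _ (e / 2)%R e20.
- move=> u1 u2 t [h1 [ch1 Vh1 u1h1]] [h2 [ch2 Vh2 u2h2]] t01.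
  exists (epi_sum (epi_mul t h1) (epi_mul (1 - t)%R h2)); split.
  + exact: Conv_c_epi_mean.
  + exact: concave_lower_bound.
  + by move=> i; exact: epi_mean_minorant.
- move=> a a0 suma; have [h SOh [r [kr rN ar]]] := HN a a0 suma.
  have oh := SOh.1; have ogh := orthogonalM og oh.
  exists (fun i => r i - C i)%R.
    exists (outer_lin (rotate (g *m h)%R psi) Y); split.
    + exact: Conv_c_outer_lin_admissible.
    + by apply: Phi_star_le => //; rewrite rotations_SO; exact: special_orthogonalM.
    + move=> i x; rewrite (outer_lin_rotateE _ px0y ogh).
      apply: le_trans (affine_sup_ge _ _ (Lw _ (yL i)).1).
      have := kr i; rewrite /k /orbit invmxM// mulmxA.
      case: (legendre psi _) => [l| |]//= [lr].
      by rewrite -EFinB lee_fin -lr; lra.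
  split.
    move=> i; have r0 : (0 <= r i)%R by rewrite -lee_fin -kr; exact: (HC i).1.
    have := rN i; have := ler_norm N.
    have := ler_norm (J i); have := ler_norm (- J i)%R; rewrite normrN.
    have : (`|J i| <= \sum_i `|J i|)%R by rewrite (bigD1 i)//= lerDl sumr_ge0.
    have JE : J i = (w (y_ i) + C i)%R by [].
    by move=> *; rewrite ler_norml; apply/andP; split; lra.
  rewrite (eq_bigr (fun i => a i * (r i - (J i + e / 2)))%R)// => i _.
  by rewrite /J; ring.
- by rewrite card_ord lt0n size_eq0.
move=> u [h [ch Vh uh]] ule; exists h; split => // y x /seq_tnthP[i yi].
apply: le_trans (uh i x); rewrite lee_fin; have := ule i.
by rewrite /y_ -yi; lra.
Qed.

(** Slopes at which the transform of [psi_rot] is infinite contribute nothing to the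
    supremum and are discarded, so that the remaining constants are real. *)
Lemma Phi_star_le_sym g Y : special_orthogonal_group R n g -> YY Y ->
  Phi_star Phi psi YY <= Phi (outer_lin (rotate g psi_rot) Y).
Proof.
move=> SOg YYY; have og := SOg.1.
have [_ _ [x1 px1] _ _] := psi_rot_Conv_c.
have [Yo [YoY posYo psiM]] := admissible_slopes_bounded n_gt0 (YY_admissible YYY).
have [x2] := outer_lin_rotate_proper Y px1 og.
rewrite (outer_lin_rotateE _ px1 og) => px2.
pose v y := legendre psi_rot (invmx g *m y)%R; pose w y := fine (v y).
pose Y' := Y `&` [set y | v y < +oo].
have vw y : Y' y -> v y = (w y)%:E.
  move=> [_ /= vy]; rewrite /w fineK// fin_numE -ltNye -ltey vy andbT.
  exact: legendre_proper_gt px1.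
have vE : affine_sup v Y = affine_sup (EFin \o w) Y'.
  apply/funext => x; apply/eqP; rewrite eq_le; apply/andP; split.
    apply/affine_sup_leP => y Yy; have [vy|] := ltP (v y) +oo.
      by rewrite vw//; apply: (affine_sup_ge (EFin \o w)).
    by rewrite leye_eq => /eqP ->; rewrite leNye.
  apply/affine_sup_leP => y Y'y.
  rewrite (_ : (EFin \o w) y = v y); last by rewrite vw.
  by apply: affine_sup_ge; exact: Y'y.1.
have YoY' : Yo `<=` Y'.
  move=> y Yoy; split; first exact: YoY.
  have [M psiMy] := psiM y Yoy; apply: (@epi_sym_finite _ M) => z'.
  by rewrite enorm_invmx//; exact: psiMy.
rewrite vE; apply: affine_sup_limit => //.
- by move=> i b; apply: (pos_subset YoY'); rewrite posYo.
- by exists x2; rewrite -vE.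
move=> L e LY' e0; have [->|L0] := eqVneq L [::].
  exists (outer_lin (rotate g psi) Y); split => //.
    exact: Conv_c_outer_lin_admissible.
  by apply: Phi_star_le => //; rewrite rotations_SO.
apply: (finite_epi_mean_minorant SOg YYY) => // y /LY' Y'y; split; first exact: Y'y.1.
exact: vw.
Qed.

End symmetrization.

End functional.

Unset Implicit Arguments.

Theorem theorem2p2 (R : realType) (n : nat) (n_gt0 : (0 < n)%N)
    (mu : probability (borel_mx R n) R) (mu_haar : haar_SO mu)
    (Phi : ('cV[R]_n -> \bar R) -> \bar R)
    (Phi_values : one_sided_values Phi)
    (Phi_usc : usc_functional Phi)
    (Phi_concave : concave_functional Phi)
    (Phi_decreasing : decreasing_functional Phi)
    (psi psi_rot : 'cV[R]_n -> \bar R)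
    (psi_Conv_c : Conv_c R n psi)
    (psi_rotE : is_rot_epi_sym mu psi psi_rot)
    (YY : set (set 'cV[R]_n))
    (YY_admissible : YY `<=` admissible_slopes psi) :
  Phi_star Phi psi YY <= Phi_star Phi psi_rot YY /\
  (forall (Y : set 'cV[R]_n) (g : 'M[R]_n),
     YY Y -> orthogonal_group R n g ->
     Conv_c R n (outer_lin (rotate g psi) Y) /\
     Conv_c R n (outer_lin (rotate g psi_rot) Y)).
Proof.
suff [[x1 px1] [rot_fin rot_le]] :
    (exists x1, psi_rot x1 != +oo) /\
    (forall z (M : R), (forall z', (enorm z' <= enorm z)%R ->
       legendre psi z' <= M%:E) -> legendre psi_rot z < +oo) /\
    (forall g Y, rotations g -> YY Y ->
       Phi_star Phi psi YY <= Phi (outer_lin (rotate g psi_rot) Y)).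
  split; first by apply/ereal_infP => _ [g [Y [rg YYY ->]]]; exact: rot_le.
  move=> Y g YYY og; split; first exact: Conv_c_outer_lin_admissible YYY og.
  exact: (Conv_c_outer_lin_rot n_gt0 YY_admissible px1 rot_fin YYY og).
move: psi_rotE; rewrite /is_rot_epi_sym; case: eqVneq => [n1 ->|n1 [prC prE]].
  split; first exact: epi_sym_dim1_proper.
  split; first by move=> z M; exact: epi_sym_dim1_finite.
  by move=> g Y; exact: Phi_star_le_sym_dim1.
have rotSO : @rotations R n = special_orthogonal_group R n.
  by rewrite /rotations (negbTE n1).
split; first by have [_ _ px _ _] := prC.
split; first by move=> z M; exact: (epi_sym_finite psi_Conv_c mu_haar.1 prE).
move=> g Y; rewrite rotSO.
exact: (Phi_star_le_sym n_gt0 Phi_usc Phi_concave Phi_decreasing psi_Conv_c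
  YY_admissible mu_haar.1 rotSO prC prE).
Qed.
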